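(* Let $f$ be a continuous self-map of a topological tree $T$, let $\tilde f$ be the induced map on the hyperspace of subcontinua of $T$, and let $\mathrm{C}(\tilde f)=\overline{\operatorname{Rec}(\tilde f)}$ be its Birkhoff center. If $A\in \mathrm{C}(\tilde f)$ is nondegenerate, then $A$ is either periodic (for $\tilde f$) or asymptotically degenerate. Moreover, every two distinct nondegenerate but asymptotically degenerate elements of $\mathrm{C}(\tilde f)$ are disjoint (as subsets of $T$). In particular, for every nondegenerate and asymptotically degenerate $A\in \mathrm{C}(\tilde f)$ and for all integers $0\le m<k$, $f^m(A)\cap f^k(A)=\emptyset$.
   Context: A topological graph is a continuum (compact connected metric space) homeomorphic to the geometric carrier of a (finite) one-dimensional simplicial complex; a topological tree is a topological graph containing no subset homeomorphic to the circle. The hyperspace of all nonempty subcontinua of $T$ (including singletons) carries the Hausdorff metric, and $\tilde f(A)=f(A)$. A continuum is nondegenerate if it is not a singleton. For a dynamical system $(X,g)$, a point $x$ is recurrent if $x\in\omega_g(x)$, $\operatorname{Rec}(g)$ is the set of recurrent points, and the Birkhoff center is $\mathrm{C}(g)=\overline{\operatorname{Rec}(g)}$. A continuum $A\subset T$ is asymptotically degenerate if $\lim_{n\to\infty}\operatorname{diam} f^n(A)=0$. *)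

(* Defs.v *)
From HB Require Import structures.
From mathcomp Require Import all_boot all_order all_algebra.
From mathcomp Require Import all_classical all_reals.
From mathcomp Require Import topology normedtype.

Set Implicit Arguments.
Unset Strict Implicit.
Unset Printing Implicit Defensive.

Import Order.TTheory GRing.Theory Num.Theory.
Import numFieldNormedType.Exports.

Local Open Scope classical_set_scope.
Local Open Scope ring_scope.

Section Dynamics.
Context {X : topologicalType}.
Implicit Types (g : X -> X) (x : X).

Definition omega_limit g x : set X := cluster ((fun n => iter n g x) @ \oo).

Definition Rec g : set X := [set x | omega_limit g x x].

Definition birkhoff_center g : set X := closure (Rec g).

Definition periodic g x := exists2 n, (0 < n)%N & iter n g x = x.

End Dynamics.

Definition homeomorphic {X Y : topologicalType} (A : set X) (B : set Y) :=
  exists (h : X -> Y) (k : Y -> X),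
    [/\ {within A, continuous h}, {within B, continuous k},
        h @` A = B, k @` B = A &
        {in A, cancel h k} /\ {in B, cancel k h}].

Definition simplicial_complex n (K : {set {set 'I_n}}) :=
  [/\ forall s, s \in K -> s != finset.set0,
      (forall v, [set v]%SET \in K) &
      forall s t : {set 'I_n}, s \in K -> t \subset s -> t != finset.set0 -> t \in K].

Definition complex_dim n (K : {set {set 'I_n}}) : nat :=
  (\max_(s in K) #|s|.-1)%N.

(* Points are given by their barycentric coordinates: the simplex s is the
   convex hull of the standard basis vectors of R^n indexed by s. *)
Definition geometric_carrier (R : realType) n (K : {set {set 'I_n}}) :
    set 'rV[R]_n :=
  [set x | [/\ forall i, 0 <= x 0 i, \sum_i x 0 i = 1 &
               [set i | x 0 i != 0]%SET \in K]].
Arguments geometric_carrier R {n} K.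

Definition unit_circle (R : realType) : set (R * R) :=
  [set p | p.1 ^+ 2 + p.2 ^+ 2 = 1].
Arguments unit_circle R : clear implicits.

Definition is_continuum {X : topologicalType} (A : set X) :=
  [/\ A !=set0, compact A & connected A].

Definition topological_graph (R : realType) (T : metricType R) :=
  is_continuum [set: T] /\
  exists n (K : {set {set 'I_n}}),
    [/\ simplicial_complex K, complex_dim K = 1%N &
        homeomorphic [set: T] (geometric_carrier R K)].

Definition topological_tree (R : realType) (T : metricType R) :=
  topological_graph T /\
  ~ exists S : set T, homeomorphic S (unit_circle R).

Definition diam (R : realType) (T : metricType R) (A : set T) : R :=
  sup [set mdist p.1 p.2 | p in A `*` A].

Definition dist_to (R : realType) (T : metricType R) (B : set T) (x : T) : R :=
  inf [set mdist x y | y in B].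

Definition hausdorff_dist (R : realType) (T : metricType R) (A B : set T) : R :=
  Num.max (sup [set dist_to B x | x in A]) (sup [set dist_to A y | y in B]).

Record subcontinuum (R : realType) (T : metricType R) := Subcontinuum {
  subcontinuum_set :> set T;
  subcontinuumP : is_continuum subcontinuum_set }.

Section HausdorffMetric.
Context {R : realType} {T : metricType R}.
Implicit Types A B C : subcontinuum T.

Lemma subcontinuum_inj A B : A = B :> set T -> A = B.
Proof.
case: A B => [A cA] [B cB] /= AB; rewrite -{}AB in cB *.
by congr Subcontinuum; exact: Prop_irrelevance.
Qed.

Let dist_lb (B : set T) x : has_lbound [set mdist x y | y in B].
Proof. by exists 0 => _ [y _ <-]; exact: mdist_ge0. Qed.

Let dist_to_le (B : set T) x y : B y -> dist_to B x <= mdist x y.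
Proof. by move=> By; apply: ge_inf => //; exists y. Qed.

Let le_dist_to (B : set T) x r : B !=set0 ->
  (forall y, B y -> r <= mdist x y) -> r <= dist_to B x.
Proof.
move=> [y By] h; apply: lb_le_inf; first by exists (mdist x y), y.
by move=> _ [z Bz <-]; exact: h.
Qed.

Let mdist_ub A y : exists M, forall x, (A : set T) x -> mdist x y <= M.
Proof.
have [_ cA _] := subcontinuumP A.
have cd : continuous (fun x : T => mdist x y : R).
  move=> x; apply/cvgrPdist_lt => e e0.
  have : nbhs x (ball x e) by exact: nbhsx_ballx.
  apply: filterS => z; rewrite ballEmdist/= => xz.
  apply: le_lt_trans xz; rewrite ler_norml; apply/andP; split.
    rewrite lerNl opprB lerBlDr (metric_sym x z); exact: metric_triangle.
  by rewrite lerBlDr; exact: metric_triangle.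
have /compact_bounded[M [_ HM]] : compact [set (mdist x y : R) | x in A].
  by apply: continuous_compact => //; exact: continuous_subspaceT.
exists (M + 1) => x Ax.
apply: le_trans (ler_norm _) _; apply: HM; first by rewrite ltrDl.
by exists x.
Qed.

Let dist_ub A B : has_ubound [set dist_to B x | x in A].
Proof.
have [[y By] _ _] := subcontinuumP B; have [M HM] := mdist_ub A y.
by exists M => _ [x Ax <-]; apply: le_trans (HM x Ax); exact: dist_to_le.
Qed.

Let hdist A B : R := hausdorff_dist A B.

Let hdistC A B : hdist A B = hdist B A.
Proof. by rewrite /hdist /hausdorff_dist maxC. Qed.

Let dist_to_hdist A B x : (A : set T) x -> dist_to B x <= hdist A B.
Proof.
by move=> Ax; rewrite le_max; apply/orP; left; apply: ub_le_sup => //; exists x.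
Qed.

Let hdist_le A B r : (forall x, (A : set T) x -> dist_to B x <= r) ->
  (forall y, (B : set T) y -> dist_to A y <= r) -> hdist A B <= r.
Proof.
have [[a Aa] _ _] := subcontinuumP A; have [[b Bb] _ _] := subcontinuumP B.
move=> hA hB; rewrite ge_max; apply/andP; split; apply: ge_sup.
- by exists (dist_to B a), a.
- by move=> _ [x Ax <-]; exact: hA.
- by exists (dist_to A b), b.
- by move=> _ [x Ax <-]; exact: hB.
Qed.

Let dist_to_ge0 B x : 0 <= dist_to B x.
Proof.
have [B0 _ _] := subcontinuumP B.
by apply: le_dist_to => // y _; exact: mdist_ge0.
Qed.

Let hdistxx A : hdist A A = 0.
Proof.
have [[a Aa] _ _] := subcontinuumP A.
apply/eqP; rewrite eq_le; apply/andP; split.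
  by apply: hdist_le => x Ax; rewrite -(mdistxx x); exact: dist_to_le.
by apply: le_trans (dist_to_hdist A Aa); exact: dist_to_ge0.
Qed.

Let hdist_triangle B A C : hdist A C <= hdist A B + hdist B C.
Proof.
have H A' B' C' x : (A' : set T) x -> dist_to C' x <= hdist A' B' + hdist B' C'.
  move=> Ax; have [B0 _ _] := subcontinuumP B'.
  have [C0 _ _] := subcontinuumP C'.
  rewrite -lerBlDr; apply: le_trans (dist_to_hdist B' Ax).
  apply: le_dist_to => // y By; rewrite lerBlDr -lerBlDl.
  apply: le_trans (dist_to_hdist C' By).
  apply: le_dist_to => // z Cz; rewrite lerBlDl.
  by apply: le_trans (metric_triangle x y z); exact: dist_to_le.
apply: hdist_le => x; first exact: H.
by rewrite addrC (hdistC A) (hdistC B); exact: H.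
Qed.

Let hdist_sub A B : hdist A B = 0 -> A `<=` B.
Proof.
move=> AB0 x Ax; have [B0 cB _] := subcontinuumP B.
have clB : closed B by apply: compact_closed => //; exact: metric_hausdorff.
apply: clB => U /nbhs_ballP[e /= e0 xeU].
apply: contrapT => BU.
suff : e <= dist_to B x.
  move=> /le_trans/(_ (dist_to_hdist B Ax)).
  by rewrite AB0 leNgt e0.
apply: le_dist_to => // y By; rewrite leNgt; apply/negP => xy.
by apply: BU; exists y; split => //; apply: xeU; rewrite ballEmdist.
Qed.

Let hdist_positivity A B : hdist A B = 0 -> A = B.
Proof.
move=> AB; apply: subcontinuum_inj; apply/seteqP; split; apply: hdist_sub => //.
by rewrite hdistC.
Qed.

HB.instance Definition _ := gen_eqMixin (subcontinuum T).
HB.instance Definition _ := gen_choiceMixin (subcontinuum T).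
HB.instance Definition _ := isMetric.Build R (subcontinuum T)
  hdistxx hdist_positivity hdistC hdist_triangle.

Lemma mdist_subcontinuumE A B : mdist A B = hausdorff_dist A B.
Proof. by []. Qed.

Lemma is_continuum_image (f : T -> T) A :
  continuous f -> is_continuum (f @` A).
Proof.
have [[a Aa] cA coA] := subcontinuumP A => cf.
have cfA : {within A, continuous f} by exact: continuous_subspaceT.
split; first by exists (f a), a.
  exact: continuous_compact.
exact: connected_continuous_connected.
Qed.

Definition induced_map (f : T -> T) (cf : continuous f) A : subcontinuum T :=
  Subcontinuum (is_continuum_image A cf).

Definition nondegenerate_continuum A := ~ exists x, A = [set x] :> set T.

Definition asymptotically_degenerate (f : T -> T) A :=
  diam (iter n f @` A) @[n --> \oo] --> (0 : R).

End HausdorffMetric.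

(* Main.v *)
Require Import Defs.
From HB Require Import structures.
From mathcomp Require Import all_boot all_order all_algebra.
From mathcomp Require Import all_classical all_reals.
From mathcomp Require Import topology normedtype.
From mathcomp Require Import lra.

Set Implicit Arguments.
Unset Strict Implicit.
Unset Printing Implicit Defensive.

Import Order.TTheory GRing.Theory Num.Theory.
Import numFieldNormedType.Exports.

Local Open Scope classical_set_scope.
Local Open Scope ring_scope.

(** In a tree, hull c x denotes the arc from c to x, and x <=_c y means that x
lies on hull c y. For every root c the tree is a union of a bounded number of
<=_c-chains (induction on the edges: a new edge meets the previous part in one
point, since otherwise two arcs with common endpoints would form a circle).

The key fact is that there is M > 0, depending only on the tree, such that a
recurrent continuum D with f^n(D) meeting f^(n+q)(D) satisfies
f~^(Mq)(D) = D. Indeed some f^q-fixed point c lies in D. Put g = f^q and let A be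
a continuum that is recurrent under g~ and contains c. If z <=_c y for some y in
g^j(hull c z), then hull c z grows under g^j. A chain x_0, x_1, ... with x_(i+1)
in g(hull c x_i) either contains such a z with j bounded, or can be shortened to
bounded length; recurrence then forces every <=_c-maximal point of A to be in
all the sets g^(Mk)(A).

Because M is uniform, the conclusion passes to limits of recurrent continua. A
continuum A in the closure contains a cut point x belonging to all nearby
continua. If A is not asymptotically degenerate, two of its iterates share such
a cut point, hence A is periodic; if A is asymptotically degenerate and two
iterates of A meet, then d(f^j x, f^(j+q) x) tends to 0, which makes the nearby
recurrent D meet its image. Finally, if A and B are asymptotically degenerate and
meet, a periodic D near A meets every recurrent E near B; by the chain bound one
of the disjoint sets f^(kP)(E), with P a period of D, lies in D, so E does. *)

(** * Arcs and trees *)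

Section Connectedness.
Context {T : topologicalType}.
Implicit Types (A B C E F G : set T) (x y z : T).

(** If [C] missed the intersection of [F] and [G], its trace on [F] would be closed in [C] and also
    open, being the complement of [G] in [C]; by connectedness it would be all of [C]. *)
Lemma connected_meet_closedI C F G : connected C -> closed F -> closed G ->
  C `<=` F `|` G -> C `&` F !=set0 -> C `&` G !=set0 ->
  C `&` (F `&` G) !=set0.
Proof.
move=> cC cF cG CFG CF [y [Cy Gy]]; apply: contrapT => noFG.
have FC : C `&` F = C.
  apply: cC => //; last by exists F.
  exists (~` G); first exact: closed_openC.
  apply/seteqP; split=> z [Cz Pz]; split=> //.
    by move=> Gz; apply: noFG; exists z.
  by case: (CFG z Cz).
by apply: noFG; exists y; split=> //; split=> //; move: Cy; rewrite -FC => -[].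
Qed.

Lemma connected_nbhs_neq E V x y : accessible_space T -> connected E ->
  E x -> E y -> x <> y -> nbhs x V -> exists z, [/\ E z, V z & z <> x].
Proof.
move=> T1 cE Ex Ey xy /nbhs_interior Vx; apply: contrapT => noz.
suff Ex1 : [set x] = E by apply: xy; move: Ey; rewrite -Ex1.
apply: cE; first by exists x.
  exists V°; first exact: open_interior.
  apply/seteqP; split=> z [].
    by move->; split=> //; exact: nbhs_singleton Vx.
  move=> Ez Vz; apply: contrapT => zx; apply: noz; exists z.
  by split=> //; exact: nbhs_singleton Vz.
exists [set x]; first exact: accessible_closed_set1.
by apply/seteqP; split=> z [] // -> .
Qed.

Lemma connected_image (U : topologicalType) (f : T -> U) C :
  continuous f -> connected C -> connected (f @` C).
Proof.
by move=> cf cC; apply: connected_continuous_connected => //;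
  exact: continuous_subspaceT.
Qed.

Lemma compact_image (U : topologicalType) (f : T -> U) C :
  continuous f -> compact C -> compact (f @` C).
Proof.
by move=> cf cC; apply: continuous_compact => //; exact: continuous_subspaceT.
Qed.

Lemma connected_pairwise C : (forall x y, C x -> C y ->
  exists D, [/\ D `<=` C, connected D, D x & D y]) -> connected C.
Proof.
move=> pair; have [->|/set0P[x Cx]] := eqVneq C set0; first exact: connected0.
suff <- : connected_component C x = C by exact: component_connected.
apply/seteqP; split; first exact: connected_component_sub.
by move=> y Cy; have [D [DC cD Dx Dy]] := pair _ _ Cx Cy; exists D.
Qed.

End Connectedness.

Section Hull.
Context {T : topologicalType}.
Implicit Types (X J C : set T) (a b c x y z : T).

(** Defined by minimality instead of a parametrization, so that lying in every connected set through
    both points is built in. If no connected subset of [X] joins the points, this is the whole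
    space; hence membership in [X] is demanded separately where it matters. *)
Definition hull_in X a b : set T :=
  [set x | forall C, C `<=` X -> connected C -> C a -> C b -> C x].

Lemma hull_in_sym X a b : hull_in X a b = hull_in X b a.
Proof.
by apply/seteqP; split=> x h C CX cC ? ?; exact: h.
Qed.

Lemma hull_in_sub X a b C : C `<=` X -> connected C -> C a -> C b ->
  hull_in X a b `<=` C.
Proof. by move=> CX cC Ca Cb x; exact. Qed.

End Hull.

Section Arcs.
Context {R : realType} {T : topologicalType} (hT : hausdorff_space T).
Implicit Types (X J C : set T) (a b c u v : T) (g : R -> T).

Definition arc_param g (s t : R) :=
  {within `[s, t], continuous g} /\ {in `[s, t] &, injective g}.

Definition is_arc J a b :=
  exists g, [/\ arc_param g 0 1, g 0 = a, g 1 = b & g @` `[0, 1] = J].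

Lemma within_comp (U V W : topologicalType) (A : set U) (B : set V)
    (f : U -> V) (g : V -> W) : {within A, continuous f} ->
  {within B, continuous g} -> (forall w, A w -> B (f w)) ->
  {within A, continuous (g \o f)}.
Proof.
move=> /subspace_continuousP cf /subspace_continuousP cg AB.
apply/subspace_continuousP => w Aw W0 /= /(cg _ (AB _ Aw)).
rewrite nbhs_simpl/= => W1; have := cf w Aw _ W1.
rewrite !nbhs_simpl/= /within/=; apply: filterS => w' h Aw'.
by apply: h => //; exact: AB.
Qed.

Lemma arc_param_sub g s t s' t' : s <= s' -> t' <= t ->
  arc_param g s t -> arc_param g s' t'.
Proof.
move=> ss tt [cg ig]; have sub x : x \in `[s', t'] -> x \in `[s, t].
  rewrite !in_itv/= => /andP[? ?].
  by rewrite (le_trans ss)// (le_trans _ tt).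
split; first by apply: continuous_subspaceW cg => x /=; exact: sub.
by move=> x y /sub xs /sub ys; exact: ig.
Qed.

Lemma arc_param_compact g s t : arc_param g s t -> compact (g @` `[s, t]).
Proof.
by move=> [cg _]; apply: continuous_compact => //; exact: segment_compact.
Qed.

Lemma arc_param_closed g s t : arc_param g s t -> closed (g @` `[s, t]).
Proof. by move=> /arc_param_compact; exact: compact_closed. Qed.

Lemma arc_param_connected g s t : arc_param g s t -> connected (g @` `[s, t]).
Proof.
by move=> [cg _]; apply: connected_continuous_connected => //;
  exact: segment_connected.
Qed.

Lemma affine_continuous (p q : R) : continuous (fun x : R => p + x * q).
Proof.
move=> x; apply: cvgD; first exact: cvg_cst.
by apply: cvgM; [exact: cvg_id|exact: cvg_cst].
Qed.

(** The membership condition makes the affine substitution carry one interval onto the other; [q]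
    may be negative, which serves to reverse arcs. *)
Lemma arc_param_affine g (p q s t s' t' : R) : q != 0 ->
  (forall x, (x \in `[s, t]) = (p + x * q \in `[s', t'])) ->
  arc_param g s' t' ->
  arc_param (fun x => g (p + x * q)) s t /\
  [set g (p + x * q) | x in `[s, t]] = g @` `[s', t'].
Proof.
move=> q0 h [cg ig]; split; first split.
- have ca := continuous_subspaceT (A := `[s, t]) (@affine_continuous p q).
  by apply: (within_comp ca cg) => x /=; rewrite h.
- move=> x y; rewrite !h => xs ys /ig -/(_ xs ys) /addrI.
  exact: mulIf.
- apply/seteqP; split=> _ [x /= xs <-]; first by exists (p + x * q); rewrite -?h.
  have e : p + (x - p) / q * q = x by rewrite divfK// addrC subrK.
  by exists ((x - p) / q); rewrite /= ?h e.
Qed.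

Lemma is_arc_param g s t : s < t -> arc_param g s t ->
  is_arc (g @` `[s, t]) (g s) (g t).
Proof.
move=> st gst; have ts : 0 < t - s by rewrite subr_gt0.
have [||gp gi] := @arc_param_affine g s (t - s) 0 1 s t _ _ gst.
- by rewrite gt_eqF.
- by move=> x; rewrite !in_itv/=; apply/andP/andP => -[? ?]; split; nra.
exists (fun x => g (s + x * (t - s))); split=> //; first by rewrite mul0r addr0.
by rewrite mul1r subrKC.
Qed.

Lemma is_arc_sym J a b : is_arc J a b -> is_arc J b a.
Proof.
move=> [g [gp g0 g1 <-]].
have [||hp hi] := @arc_param_affine g 1 (-1) 0 1 0 1 _ _ gp.
- by rewrite oppr_eq0 oner_neq0.
- by move=> x; rewrite !in_itv/=; apply/andP/andP => -[? ?]; split; lra.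
exists (fun x => g (1 + x * -1)); split=> //; first by rewrite mul0r addr0.
by rewrite mul1r subrr.
Qed.

Lemma is_arc_closed J a b : is_arc J a b -> closed J.
Proof. by move=> [g [gp _ _ <-]]; exact: arc_param_closed gp. Qed.

Lemma is_arc_connected J a b : is_arc J a b -> connected J.
Proof. by move=> [g [gp _ _ <-]]; exact: arc_param_connected gp. Qed.

Lemma is_arc_l J a b : is_arc J a b -> J a.
Proof. by move=> [g [_ <- _ <-]]; exists 0 => //=; rewrite in_itv/= lexx ler01. Qed.

Lemma is_arc_r J a b : is_arc J a b -> J b.
Proof. by move=> /is_arc_sym/is_arc_l. Qed.

Lemma itvcc_split (x : R) :
  x \in `[0, 2] -> (x \in `[0, 1]) || (x \in `[1, 2]).
Proof.
rewrite !in_itv/= => /andP[? ?]; apply/orP.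
by have [x1|x1] := leP x 1; [left|right]; apply/andP; split; lra.
Qed.

Lemma is_arc_cat J K a b c : is_arc J a b -> is_arc K b c ->
  J `&` K = [set b] -> is_arc (J `|` K) a c.
Proof.
move=> Jab /[dup] Kbc [k' [kp' k0' k1' kK]].
have cJ := is_arc_closed Jab; have cK := is_arc_closed Kbc.
have [g [gp g0 g1 gJ]] := Jab.
(* The second arc is moved to [1, 2], so that the union is parametrized by [0, 2]. *)
have [||kp kK'] := @arc_param_affine k' (-1) 1 1 2 0 1 _ _ kp'.
- by rewrite oner_neq0.
- by move=> x; rewrite !in_itv/=; apply/andP/andP => -[? ?]; split; lra.
pose k (x : R) := k' (-1 + x * 1); move: kp kK'; rewrite -/k kK => kp kK' JK.
have k0 : k 1 = b by rewrite /k mul1r addNr.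
have k1 : k 2 = c by rewrite /k mulr1; have -> : -1 + 2 = 1 :> R by lra.
clearbody k.
have Jg (x : R) : x \in `[0, 1] -> J (g x) by move=> ?; rewrite -gJ; exists x.
have Kk (x : R) : x \in `[1, 2] -> K (k x) by move=> ?; rewrite -kK'; exists x.
have m1 : 1 \in `[0, 1 : R] by rewrite in_itv/= lexx ler01.
have m1' : 1 \in `[1, 2 : R] by rewrite in_itv/= lexx; lra.
pose f x := if x <= 1 then g x else k x.
have fg (x : R) : x \in `[0, 1] -> g x = f x.
  by rewrite in_itv/= /f => /andP[_ ->].
have fk x : x \in `[1, 2] -> k x = f x.
  rewrite in_itv/= /f => /andP[x1 _]; case: ifPn => // x1'.
  by have -> : x = 1 by [lra]; rewrite k0 g1.
have split02 : [set` `[0, 2]] = [set` `[0, 1]] `|` [set` `[1, 2]] :> set R.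
  apply/seteqP; split=> x /=; first by move=> /itvcc_split/orP.
  by rewrite !in_itv/=; case=> /andP[? ?]; apply/andP; split; lra.
have fp : arc_param f 0 2.
  (* The pieces meet only at [b], the value of both at 1, so parameters on different sides of the
     joint share no other value. *)
  have eqKJ (x y : R) : x \in `[0, 1] -> y \in `[1, 2] -> g x = k y -> x = y.
    move=> xs ys e; have := Jg x xs; have := Kk y ys; rewrite -e => Kgx Jgx.
    have : (J `&` K) (g x) by [].
    rewrite JK /= => gb; move: (e); rewrite gb -{1}k0 => /esym/kp.2 -> //.
    by apply: gp.2; rewrite // gb g1.
  split.
    rewrite split02; apply: withinU_continuous; try exact: itv_closed.
      apply: (subspace_eq_continuous _ gp.1) => x; rewrite inE => xs.
      exact: fg.
    apply: (subspace_eq_continuous _ kp.1) => x; rewrite inE => xs.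
    exact: fk.
  move=> x y /itvcc_split/orP[] xs /itvcc_split/orP[] ys; rewrite -?(fg _ xs) -?(fg _ ys).
  - exact: gp.2.
  - by rewrite -(fk _ ys); exact: eqKJ.
  - by rewrite -(fk _ xs) => /esym/(eqKJ _ _ ys xs).
  - by rewrite -(fk _ xs) -(fk _ ys); exact: kp.2.
have [|h [hp h0 h1 hJ]] := @is_arc_param f 0 2 _ fp; first by lra.
have f0 : f 0 = a by rewrite -fg// in_itv/= lexx ler01.
have f2 : f 2 = c by rewrite -fk ?k1// in_itv/= lexx; lra.
exists h; split; rewrite ?h0 ?h1// hJ split02 image_setU -gJ -kK'.
by congr (_ `|` _); apply: eq_imagel => x /=; [move/fg|move/fk].
Qed.

(** [C] meets the closed pieces of the arc before and after [x], hence their intersection, which by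
    injectivity is the single point [g x]. *)
Lemma arc_param_convex g (p q s t x : R) C : arc_param g p q ->
  C `<=` g @` `[p, q] -> connected C ->
  s \in `[p, q] -> t \in `[p, q] -> x \in `[s, t] ->
  C (g s) -> C (g t) -> C (g x).
Proof.
move=> gp CJ cC; rewrite !in_itv/= => /andP[ps sq] /andP[pt tq] /andP[sx xt].
move=> Cs Ct.
have gl : arc_param g p x by apply: arc_param_sub gp => //; exact: le_trans tq.
have gr : arc_param g x q by apply: arc_param_sub gp => //; exact: le_trans sx.
have [|||z [Cz [[y1 y1s e1] [y2 y2s e2]]]] := @connected_meet_closedI _ C
  (g @` `[p, x]) (g @` `[x, q]) cC (arc_param_closed gl) (arc_param_closed gr).
- move=> z Cz; case/CJ: (Cz) => y /=; rewrite in_itv/= => /andP[py yq] <-.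
  by have [yx|xy] := leP y x; [left|right]; exists y => //=; rewrite in_itv/=;
    apply/andP; split=> //; exact: ltW.
- by exists (g s); split=> //; exists s => //=; rewrite in_itv/=; apply/andP.
- by exists (g t); split=> //; exists t => //=; rewrite in_itv/=; apply/andP.
move: y1s y2s; rewrite /= !in_itv/= => /andP[py1 y1x] /andP[xy2 y2q].
have y12 : y2 = y1.
  by apply: gp.2; rewrite ?e1// in_itv/=; apply/andP; split; lra.
suff <- : y1 = x by rewrite e1.
by rewrite y12 in xy2; apply/le_anti/andP.
Qed.

End Arcs.
Arguments is_arc R {T} J a b.

(** * Tree-like sets and their extension by an arc *)

Section TreeLike.
Context {R : realType} {T : topologicalType} (hT : hausdorff_space T).
Implicit Types (X J C : set T) (a b c u v : T) (g : R -> T).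

(** [N] need not be open; [V] is an ambient neighbourhood witnessing that [N] is a neighbourhood
    relative to [X]. *)
Definition locally_connected_in X := forall a U, X a -> nbhs a U ->
  exists N V, [/\ N `<=` U `&` X, connected N, nbhs a V & V `&` X `<=` N].

(** The inclusion in the hull says that any connected subset of [X] through the endpoints contains
    the arc; this is what excludes circles. *)
Definition arc_hulls X := forall a b, X a -> X b -> a <> b ->
  exists2 J, is_arc R J a b & J `<=` X `&` hull_in X a b.

(** [k] is a colouring with [r] colours whose classes are chains for the order of root [c]; the
    number of colours does not depend on the root. *)
Definition chain_width X r := forall c, X c ->
  exists k : T -> nat, (forall x, X x -> (k x < r)%N) /\
    forall x y, X x -> X y -> k x = k y ->
      hull_in X c x y \/ hull_in X c y x.

Definition tree_like X := [/\ closed X, locally_connected_in X, arc_hulls X &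
  exists r, chain_width X r].

(** At a common point the two connected neighbourhoods are united; at a point of one set only, the
    neighbourhood is shrunk to avoid the other set, which is closed. *)
Lemma locally_connected_inU X J : closed X -> closed J ->
  locally_connected_in X -> locally_connected_in J ->
  locally_connected_in (X `|` J).
Proof.
move=> cX cJ lX lJ.
have oneside Y Z a U : closed Z -> locally_connected_in Y -> Y a -> ~ Z a ->
    nbhs a U -> exists N V, [/\ N `<=` U `&` (Y `|` Z), connected N, nbhs a V &
      V `&` (Y `|` Z) `<=` N].
  move=> cZ lY Ya Za /(lY _ _ Ya)[N [V [NU cN Va VN]]].
  exists N, (V `&` ~` Z); split=> //.
  - by move=> x /NU[Ux Yx]; split=> //; left.
  - apply: filterI => //; apply: open_nbhs_nbhs; split=> //.
    exact: closed_openC.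
  - by move=> x [[Vx Zx] [Yx|//]]; apply: VN.
move=> a U XJa aU; have [Xa|Xa] := pselect (X a); last first.
  by rewrite setUC; case: XJa => // Ja; apply: oneside.
have [Ja|Ja] := pselect (J a); last exact: oneside.
have [N [V [NU cN Va VN]]] := lX a U Xa aU.
have [N' [V' [NU' cN' Va' VN']]] := lJ a U Ja aU.
exists (N `|` N'), (V `&` V'); split.
- by move=> x [/NU[Ux Xx]|/NU'[Ux Jx]]; split=> //; [left|right].
- apply: connectedU => //; exists a.
  by split; [apply: VN|apply: VN']; split=> //; exact: nbhs_singleton.
- exact: filterI.
- by move=> x [[Vx Vx'] [Xx|Jx]]; [left; apply: VN|right; apply: VN'].
Qed.

(** A short parameter interval has connected image, and the remaining parameters have compact image,
    whose complement is the ambient neighbourhood. *)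
Lemma arc_locally_connected J a b : is_arc R J a b -> locally_connected_in J.
Proof.
move=> [g [gp _ _ gJ]] p U Jp pU; move: (Jp); rewrite -gJ => -[t /= t01 gt].
have /subspace_continuousP cg := gp.1.
have gtU : nbhs (g t) U by rewrite gt.
have := cg t t01 U gtU.
rewrite nbhs_simpl/= /within/= => /nbhs_ballP[e /= e0 he].
pose I : set R := [set` `[0, 1]] `&` ball t e.
have bt : ball t e t by exact: ballxx.
have cI : connected I.
  apply/connected_intervalP => x y [/= xs xe] [/= ys ye] z /andP[xz zy].
  move: xs ys xe ye; rewrite /I /ball/= !in_itv/= !ltr_norml.
  move=> /andP[? ?] /andP[? ?] /andP[? ?] /andP[? ?].
  by split; apply/andP; split; lra.
have sub01 : I `<=` [set` `[0, 1]] by move=> x [].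
exists (g @` I), (~` (g @` ([set` `[0, 1]] `\` ball t e))); split.
- by move=> _ [x [/= x01 xe] <-]; split; [exact: he|exists x].
- apply: connected_continuous_connected => //.
  exact: continuous_subspaceW gp.1.
- apply: open_nbhs_nbhs; split.
    apply: closed_openC; apply: compact_closed => //.
    apply: continuous_compact.
      by apply: continuous_subspaceW gp.1; exact: subDsetl.
    rewrite setDE; apply: compact_closedI; first exact: segment_compact.
    by apply: open_closedC; exact: ball_open.
  move=> [x [/= x01 xe] gx]; apply: xe.
  by have -> : x = t by apply: gp.2 => //; rewrite gx gt.
- move=> z [nz [x /= x01 gx]]; exists x => //; split=> //.
  by apply: contrapT => xe; apply: nz; exists x.
Qed.

Lemma wedge_mem X J u C : closed X -> closed J -> X `&` J = [set u] ->
  connected C -> C `<=` X `|` J -> C `&` X !=set0 -> C `&` J !=set0 -> C u.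
Proof.
move=> cX cJ XJ cC CXJ CX CJ.
have [z [Cz]] := connected_meet_closedI cC cX cJ CXJ CX CJ.
by rewrite XJ => <-.
Qed.

(* C `&` X is the image of C under the retraction collapsing J to u. *)
Lemma wedge_connectedI X J u C : closed X -> closed J -> X `&` J = [set u] ->
  connected C -> C `<=` X `|` J -> connected (C `&` X).
Proof.
move=> cX cJ XJ cC CXJ.
have [->|/set0P CX] := eqVneq (C `&` X) set0; first exact: connected0.
have [CJ0|/set0P CJ] := eqVneq (C `&` J) set0.
  suff -> : C `&` X = C by [].
  apply/setIidPl => x Cx; case: (CXJ x Cx) => // Jx.
  by have : (C `&` J) x by []; rewrite CJ0.
have Cu := wedge_mem cX cJ XJ cC CXJ CX CJ.
have [Xu Ju] : (X `&` J) u by rewrite XJ.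
pose r x := if x \in X then x else u.
have rX x : X x -> r x = x by move=> Xx; rewrite /r mem_set.
have cr : {within X `|` J, continuous r}.
  apply: withinU_continuous => //.
    have cid : {within X, continuous (fun x : T => x)}.
      by apply: continuous_subspaceT => x; exact: cvg_id.
    by apply: (subspace_eq_continuous _ cid) => x; rewrite inE => /rX.
  have cst : {within J, continuous (fun _ : T => u)}.
    by apply: continuous_subspaceT => x; exact: cvg_cst.
  apply: (subspace_eq_continuous _ cst) => x; rewrite inE => Jx.
  rewrite /r /from_subspace/=; case: ifPn => // /set_mem Xx.
  by have : (X `&` J) x by []; rewrite XJ.
suff -> : C `&` X = r @` C.
  apply: connected_continuous_connected => //.
  exact: continuous_subspaceW cr.
apply/seteqP; split=> [x [Cx Xx]|_ [x Cx <-]]; first by exists x; rewrite ?rX.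
by rewrite /r; case: ifPn => // /set_mem Xx.
Qed.

Section Wedge.
Context (X J : set T) (u : T) (g : R -> T) (cX : closed X)
  (gp : arc_param g 0 1) (g0 : g 0 = u) (gJ : g @` `[0, 1] = J)
  (XJ : X `&` J = [set u]).

Let cJ : closed J. Proof. by rewrite -gJ; exact: arc_param_closed gp. Qed.

Let Xu : X u.
Proof. by have : [set u] u by []; rewrite -XJ => -[]. Qed.

Let Jg t : t \in `[0, 1] -> J (g t).
Proof. by move=> t01; rewrite -gJ; exists t. Qed.

Let in0 : 0 \in `[0, 1 : R]. Proof. by rewrite in_itv/= lexx ler01. Qed.

Lemma wedge_hull_in c x : X c -> X x ->
  hull_in X c x `<=` hull_in (X `|` J) c x.
Proof.
move=> Xc Xx z h C CXJ cC Cc Cx.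
suff [] : (C `&` X) z by [].
by apply: h => //; exact: wedge_connectedI XJ cC CXJ.
Qed.

Lemma wedge_root C c t : connected C -> C `<=` X `|` J -> C c -> X c ->
  t \in `[0, 1] -> C (g t) -> C u.
Proof.
move=> cC CXJ Cc Xc t01 Ct; apply: (wedge_mem cX cJ XJ cC CXJ).
  by exists c.
by exists (g t); split=> //; exact: Jg.
Qed.

(** By the retraction onto [J] in place of [X], the trace of [C] on [J] is connected, and connected
    subsets of an arc are convex in the parameter. *)
Lemma wedge_arc C (s t x : R) : connected C -> C `<=` X `|` J ->
  s \in `[0, 1] -> t \in `[0, 1] -> x \in `[s, t] ->
  C (g s) -> C (g t) -> C (g x).
Proof.
move=> cC CXJ s01 t01 xst Cs Ct.
suff [] : (C `&` J) (g x) by [].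
apply: (@arc_param_convex _ _ hT g 0 1 s t x (C `&` J) gp _ _ s01 t01 xst).
- by rewrite gJ; exact: subIsetr.
- apply: (wedge_connectedI cJ cX); rewrite 1?setIC//; last by rewrite setUC.
  exact: XJ.
- by split=> //; exact: Jg.
- by split=> //; exact: Jg.
Qed.

(** The new arcs are subarcs of [J] and, between a point of [X] and a point of [J], the old arc to
    [u] followed by an initial piece of [J]. *)
Lemma wedge_arc_hulls : arc_hulls X -> arc_hulls (X `|` J).
Proof.
move=> hX a b.
have sym a' b' : (exists2 K, is_arc R K a' b' &
    K `<=` (X `|` J) `&` hull_in (X `|` J) a' b') ->
    exists2 K, is_arc R K b' a' & K `<=` (X `|` J) `&` hull_in (X `|` J) b' a'.
  by move=> [K /is_arc_sym ? ?]; exists K => //; rewrite hull_in_sym.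
have JXJ (s t : R) : 0 <= s -> t <= 1 -> g @` `[s, t] `<=` X `|` J.
  move=> s0 t1 z [x /=]; rewrite in_itv/= => /andP[? ?] <-; right; apply: Jg.
  by rewrite in_itv/=; apply/andP; split; lra.
have hXX a' b' : X a' -> X b' -> a' <> b' -> exists2 K, is_arc R K a' b' &
    K `<=` (X `|` J) `&` hull_in (X `|` J) a' b'.
  move=> Xa Xb /(hX _ _ Xa Xb)[K Kab KX]; exists K => // z /KX[Xz hz].
  by split; [left|exact: wedge_hull_in].
have hJJ (s t : R) : s \in `[0, 1] -> t \in `[0, 1] -> s < t ->
    exists2 K, is_arc R K (g s) (g t) &
      K `<=` (X `|` J) `&` hull_in (X `|` J) (g s) (g t).
  move=> s01 t01 st; move: (s01) (t01); rewrite !in_itv/= => /andP[? ?] /andP[? ?].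
  exists (g @` `[s, t]).
    by apply: is_arc_param => //; apply: arc_param_sub gp.
  move=> z zst; split; first by apply: JXJ zst.
  by case: zst => x /= xst <- C CXJ cC Cs Ct; exact: wedge_arc Cs Ct.
have hXJ a' (t : R) : X a' -> t \in `[0, 1] -> 0 < t -> a' <> g t ->
    exists2 K, is_arc R K a' (g t) &
      K `<=` (X `|` J) `&` hull_in (X `|` J) a' (g t).
  move=> Xa t01 t0 ab; have [->|/eqP au] := eqVneq a' u.
    by rewrite -g0; exact: hJJ.
  have [K Kau KX] := hX _ _ Xa Xu au.
  have [L Lut LX] := hJJ 0 t in0 t01 t0.
  move: (t01); rewrite in_itv/= => /andP[_ t1].
  have gpt : arc_param g 0 t by exact: arc_param_sub gp.
  have gt := is_arc_param t0 gpt; rewrite g0 in gt.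
  exists (K `|` g @` `[0, t]).
    apply: (is_arc_cat hT Kau gt); apply/seteqP; split=> [z [Kz gz]|z ->].
      rewrite -XJ; split; first by have [] := KX _ Kz.
      by move: gz => [x /=]; rewrite in_itv/= => /andP[? ?] <-; apply: Jg;
         rewrite in_itv/=; apply/andP; split=> //; exact: le_trans t1.
    by split; [exact: is_arc_r Kau|exact: is_arc_l gt].
  move=> z; case=> [/KX[Xz hz]|gz].
    split; first by left.
    move=> C CXJ cC Ca Ct; apply: (wedge_hull_in Xa Xu hz) => //.
    exact: (wedge_root cC CXJ Ca Xa t01 Ct).
  split; first by apply: JXJ gz.
  case: gz => x /= xst <- C CXJ cC Ca Ct; apply: (wedge_arc cC CXJ in0 t01 xst) => //.
  by rewrite g0; exact: (wedge_root cC CXJ Ca Xa t01 Ct).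
have inJ z : (X `|` J) z -> ~ X z -> exists2 t, t \in `[0, 1] & z = g t /\ 0 < t.
  move=> [//|Jz] nXz; move: Jz; rewrite -gJ => -[t /= t01 gt].
  exists t => //; split=> //; move: (t01); rewrite in_itv/= => /andP[t0 _].
  rewrite lt_neqAle t0 andbT; apply/eqP => t0'.
  by apply: nXz; rewrite -gt -t0' g0.
move=> XJa XJb ab.
have [Xa|Xa] := pselect (X a); have [Xb|Xb] := pselect (X b).
- exact: hXX.
- have [t t01 [bt t0]] := inJ _ XJb Xb; rewrite bt in ab *; exact: hXJ.
- have [t t01 [at_ t0]] := inJ _ XJa Xa; rewrite at_ in ab *.
  by apply: sym; apply: hXJ => // /esym.
- have [s s01 [as_ s0]] := inJ _ XJa Xa; have [t t01 [bt t0]] := inJ _ XJb Xb.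
  rewrite as_ bt in ab *.
  have [st|ts|st] := ltgtP s t; first exact: hJJ.
    by apply: sym; exact: hJJ.
  by rewrite st in ab.
Qed.

(** Seen from a root in [X], the new part of [J] is a single chain and takes the colour [r]. Seen
    from a root [g t0] on [J], it splits at [t0] into two chains, coloured [r] and [r.+1], while [X]
    is coloured as seen from [u]. *)
Lemma wedge_chain_width r : chain_width X r -> chain_width (X `|` J) r.+2.
Proof.
move=> wX c XJc.
have Jin x : (X `|` J) x -> ~ X x -> exists2 t, t \in `[0, 1] & g t = x.
  by move=> [//|]; rewrite -gJ => -[t ? ?] _; exists t.
have [Xc|Xc] := pselect (X c).
  have [k [kr kc]] := wX c Xc.
  exists (fun x => if x \in X then k x else r); split.
    move=> x _; case: ifPn => [/set_mem/kr kx|_]; last by rewrite ltnW.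
    by rewrite ltnS ltnW// ltnS ltnW.
  move=> x y XJx XJy; case: ifPn => [/set_mem Xx|/negP nx];
    case: ifPn => [/set_mem Xy|/negP ny].
  - by move=> /(kc _ _ Xx Xy)[h|h]; [left|right]; exact: wedge_hull_in.
  - by move=> kx; have := kr _ Xx; rewrite kx ltnn.
  - by move=> kx; have := kr _ Xy; rewrite kx ltnn.
  rewrite inE in nx; rewrite inE in ny => _.
  have [s s01 <-] := Jin _ XJx nx; have [t t01 <-] := Jin _ XJy ny.
  wlog st : s t s01 t01 / s <= t.
    move=> h; have [st|/ltW ts] := leP s t; first exact: h.
    by case: (h _ _ t01 s01 ts) => ?; [right|left].
  right=> C CXJ cC Cc Ct; apply: (wedge_arc cC CXJ in0 t01) => //.
    by move: s01 t01; rewrite !in_itv/= => /andP[? ?] /andP[? ?]; apply/andP.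
  by rewrite g0; exact: (wedge_root cC CXJ Cc Xc t01 Ct).
have [t0 t001 gt0] := Jin _ XJc Xc.
have [k [kr kc]] := wX u Xu.
exists (fun x => if x \in X then k x else
  if x \in g @` `[0, t0] then r else r.+1); split.
  move=> x _; case: ifPn => [/set_mem/kr kx|_]; last by case: ifP.
  by rewrite ltnS ltnW// ltnS ltnW.
move=> x y XJx XJy; case: (boolP (x \in X)) => [/set_mem Xx|/negP nx];
  case: (boolP (y \in X)) => [/set_mem Xy|/negP ny].
- move=> /(kc _ _ Xx Xy)[h|h]; [left|right] => C CXJ cC Cc Cy;
    apply: (wedge_hull_in Xu _ h) => //; apply: (wedge_root cC CXJ Cy _ t001);
    by rewrite ?gt0.
- by move=> kx; have := kr _ Xx; rewrite kx; case: ifP; rewrite ?ltnn// ltnNge leqnSn.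
- by move=> kx; have := kr _ Xy; rewrite -kx; case: ifP; rewrite ?ltnn// ltnNge leqnSn.
rewrite inE in nx; rewrite inE in ny.
have [s s01 sx] := Jin _ XJx nx; have [t t01 ty] := Jin _ XJy ny.
move: (s01) (t01) (t001); rewrite !in_itv/= => /andP[s0 s1] /andP[t0' t1].
move=> /andP[t00 t01'].
case: (boolP (x \in g @` `[0, t0])) => [/set_mem[s' /= s's e]|/negP xs];
  case: (boolP (y \in g @` `[0, t0])) => [/set_mem[t' /= t't e']|/negP yt].
- move: s's t't; rewrite !in_itv/= => /andP[s'0 s't] /andP[t'0 t't] _.
  have es : s' = s.
    by apply: gp.2; rewrite ?e// in_itv/=; apply/andP; split=> //; lra.
  have et : t' = t.
    by apply: gp.2; rewrite ?e'// in_itv/=; apply/andP; split=> //; lra.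
  rewrite es in s't; rewrite et in t't; rewrite -sx -ty -gt0.
  have [st|ts] := leP s t; [left|right] => C CXJ cC C1 C2.
    apply: (wedge_arc cC CXJ s01 t001 _ C2 C1).
    by rewrite in_itv/=; apply/andP.
  apply: (wedge_arc cC CXJ t01 t001 _ C2 C1).
  by rewrite in_itv/=; apply/andP; split=> //; exact: ltW.
- by move/eqP; rewrite ltn_eqF.
- by move/eqP; rewrite gtn_eqF.
move=> _.
have ts : t0 < s.
  rewrite ltNge; apply/negP => st; apply: xs; rewrite inE; exists s => //=.
  by rewrite in_itv/=; apply/andP.
have tt : t0 < t.
  rewrite ltNge; apply/negP => st; apply: yt; rewrite inE; exists t => //=.
  by rewrite in_itv/=; apply/andP.
rewrite -sx -ty -gt0.
have [st|st] := leP s t; [right|left] => C CXJ cC C1 C2.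
  apply: (wedge_arc cC CXJ t001 t01 _ C1 C2).
  by rewrite in_itv/=; apply/andP; split=> //; exact: ltW.
apply: (wedge_arc cC CXJ t001 s01 _ C1 C2).
by rewrite in_itv/=; apply/andP; split; exact: ltW.
Qed.

Lemma wedge_tree_like : tree_like X -> tree_like (X `|` J).
Proof.
move=> [_ lX hX [r wX]]; split.
- exact: closedU.
- apply: locally_connected_inU => //.
  apply: (@arc_locally_connected _ (g 0) (g 1)).
  by rewrite -gJ; exact: is_arc_param.
- exact: wedge_arc_hulls.
- by exists r.+2; exact: wedge_chain_width.
Qed.

End Wedge.

Lemma tree_like1 a : tree_like [set a].
Proof.
split.
- exact: accessible_closed_set1 (hausdorff_accessible hT) _.
- move=> p U -> pU; exists [set a], setT; split.
  + by move=> _ ->; split=> //; exact: nbhs_singleton.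
  + exact: connected1.
  + exact: filterT.
  + by move=> x [].
- by move=> x y -> ->.
- exists 1%N => c ->; exists (fun=> 0%N); split=> // x y -> -> _.
  by left=> C.
Qed.

End TreeLike.
Arguments arc_hulls R {T} X.
Arguments tree_like R {T} X.

(** * Simplicial trees *)

Section Circle.
Context {R : realType} {T : topologicalType} (hT : hausdorff_space T).

(** The inverse is continuous because [k] sends closed subsets of the compact [B] to compact, hence
    closed, sets. The point [p0] is only the default value of the inverse off the image. *)
Lemma compact_injective_homeomorphic (U : topologicalType) (B : set U)
    (p0 : U) (k : U -> T) : compact B -> {within B, continuous k} ->
  (forall p q, B p -> B q -> k p = k q -> p = q) -> homeomorphic (k @` B) B.
Proof.
move=> cB ck ik; pose h y := xget p0 [set p | B p /\ k p = y].
have hk p : B p -> h (k p) = p.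
  by move=> Bp; rewrite /h; case: xgetP => [q _ [Bq /ik]|/(_ p)[]//]; exact.
exists h, k; split=> //.
- apply/continuous_closedP => F cF; apply/closed_subspaceP.
  exists (k @` (B `&` F)).
    apply: compact_closed => //; apply: continuous_compact.
      by apply: continuous_subspaceW ck => p [].
    exact: compact_closedI.
  apply/seteqP; split=> y [].
    move=> [p [Bp Fp] <-] kBp; split=> //.
    by rewrite /preimage/from_subspace/= hk.
  move=> Fy [p Bp py]; move: Fy; rewrite -py /preimage/from_subspace/=.
  by rewrite (hk p Bp) => Fp; split; exists p.
- apply/seteqP; split=> [_ [_ [p Bp <-] <-]|p Bp]; first by rewrite hk.
  by exists (k p); [exists p|rewrite hk].
- split=> y; rewrite inE; last exact: hk.
  by move=> [p Bp <-]; rewrite hk.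
Qed.

Lemma unit_circle_compact : compact (unit_circle R).
Proof.
have cB : compact ([set` `[-1, 1 : R]] `*` [set` `[-1, 1 : R]]).
  by apply: compact_setX; exact: segment_compact.
apply: subclosed_compact cB _.
- rewrite (_ : unit_circle R =
    (fun p : R * R => p.1 ^+ 2 + p.2 ^+ 2) @^-1` [set 1]) //.
  apply: closed_comp; last exact: closed_eq.
  move=> p _; apply: cvgD; rewrite expr2;
    by apply: cvgM; (exact: cvg_fst || exact: cvg_snd).
- move=> [x y]; rewrite /unit_circle /= => xy; rewrite !in_itv/=.
  by split; apply/andP; split; nra.
Qed.

(** The upper half circle is mapped along [J] and the lower one along [K]; the two maps agree on the
    horizontal diameter. *)
Lemma arcs_circle (J K : set T) a b : is_arc R J a b ->
  is_arc R K a b -> J `&` K = [set a; b] ->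
  exists S : set T, homeomorphic S (unit_circle R).
Proof.
move=> [g [gp g0 g1 gJ]] [k [kp k0 k1 kK]] JK.
(* The projection to the horizontal diameter, rescaled to [0, 1], so that (-1, 0) goes to [a] and
   (1, 0) to [b]. *)
pose s (p : R * R) := (p.1 + 1) / 2.
pose f (p : R * R) := if 0 <= p.2 then g (s p) else k (s p).
have s01 p : unit_circle R p -> s p \in `[0, 1].
  by case: p => x y; rewrite /unit_circle /s in_itv/= => xy;
    apply/andP; split; nra.
have cs : continuous s.
  move=> p; apply: cvgM; last exact: cvg_cst.
  by apply: cvgD; [exact: cvg_fst|exact: cvg_cst].
have ends p : unit_circle R p -> p.2 = 0 -> s p = 0 \/ s p = 1.
  case: p => x y; rewrite /unit_circle /s/= => xy y0.
  have /eqP : x ^+ 2 = 1 by rewrite -xy y0 expr0n addr0.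
  rewrite sqrf_eq1 => /orP[] /eqP ->.
    by right; lra.
  by left; rewrite addNr mul0r.
have gk p : unit_circle R p -> p.2 = 0 -> g (s p) = k (s p).
  by move=> cp p0; case: (ends p cp p0) => ->; rewrite ?g0 ?g1.
have cy : continuous (fun p : R * R => p.2) by move=> p; exact: cvg_snd.
pose up := unit_circle R `&` [set p | 0 <= p.2].
pose dn := unit_circle R `&` [set p | p.2 <= 0].
have cc : closed (unit_circle R).
  by apply: compact_closed unit_circle_compact; exact: norm_hausdorff.
have udE : unit_circle R = up `|` dn.
  apply/seteqP; split=> [p cp|p [[]|[]]//].
  by have [p0|/ltW p0] := leP 0 p.2; [left|right].
have fk p : dn p -> f p = k (s p).
  move=> [cp /= p0]; rewrite /f; case: ifPn => // p0'.
  by apply: gk => //; apply/le_anti/andP.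
have cf : {within unit_circle R, continuous f}.
  rewrite udE; apply: withinU_continuous.
  - by apply: closedI => //; apply: (closed_comp _ (@closed_ge _ 0)) => p _; exact: cy.
  - by apply: closedI => //; apply: (closed_comp _ (@closed_le _ 0)) => p _; exact: cy.
  - have csup : {within up, continuous s} by exact: continuous_subspaceT.
    have cgs := within_comp csup gp.1 (fun p (h : up p) => s01 p h.1).
    by apply: (subspace_eq_continuous _ cgs) => p; rewrite inE => -[_ /= p0];
      rewrite /from_subspace /f p0.
  - have csdn : {within dn, continuous s} by exact: continuous_subspaceT.
    have cks := within_comp csdn kp.1 (fun p (h : dn p) => s01 p h.1).
    by apply: (subspace_eq_continuous _ cks) => p; rewrite inE => /fk.
exists (f @` unit_circle R).
apply: (compact_injective_homeomorphic (0, 0)) => //; first exact: unit_circle_compact.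
have sq p q : unit_circle R p -> unit_circle R q -> s p = s q ->
    p.1 = q.1 /\ p.2 ^+ 2 = q.2 ^+ 2.
  case: p => x y; case: q => x' y'; rewrite /unit_circle /s/= => e e' xx.
  have xx' : x = x' by lra.
  by split=> //; move: e e'; rewrite xx' => <- /addrI.
have eqv p q : unit_circle R p -> unit_circle R q -> s p = s q ->
    0 <= p.2 * q.2 -> p = q.
  move=> cp cq /(sq _ _ cp cq)[]; case: p {cp} => x y; case: q {cq} => x' y' /=.
  move=> -> /eqP; rewrite eqf_sqr => /orP[/eqP -> //|/eqP ->].
  by rewrite mulNr oppr_ge0 => yy; have -> : y' = 0 by [nra]; rewrite oppr0.
(* A value common to both halves is an endpoint of the arcs, but the parameters 0 and 1 occur only
   where the ordinate vanishes. *)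
have mix p q : unit_circle R p -> unit_circle R q -> 0 <= p.2 -> ~~ (0 <= q.2) ->
    g (s p) = k (s q) -> p = q.
  move=> cp cq p0 q0 e.
  have : (J `&` K) (g (s p)).
    by split; [rewrite -gJ; exists (s p)|rewrite e -kK; exists (s q)] => //=; exact: s01.
  rewrite JK => ee; exfalso.
  have in0 : 0 \in `[0, 1 : R] by rewrite in_itv/= lexx ler01.
  have in1 : 1 \in `[0, 1 : R] by rewrite in_itv/= lexx ler01.
  have q01 : s q = 0 \/ s q = 1.
    case: ee => /= ee; [left|right]; apply: kp.2; rewrite ?s01// -e ee.
    - by rewrite k0.
    - by rewrite k1.
  move: q01 q0 cq; case: q {e} => x y; rewrite /s /unit_circle/= -ltNge.
  move=> q01 y0 xy; have : y ^+ 2 > 0 by rewrite exprn_even_gt0//= lt_eqF.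
  by case: q01 => q01; nra.
move=> p q cp cq; rewrite /f; case: ifPn => p0; case: ifPn => q0.
- move/(gp.2 _ _ (s01 _ cp) (s01 _ cq)) => e; apply: eqv => //; exact: mulr_ge0.
- exact: mix.
- by move/esym => e; apply/esym; exact: mix e.
- move/(kp.2 _ _ (s01 _ cp) (s01 _ cq)) => e; apply: eqv => //.
  by rewrite -ltNge in p0; rewrite -ltNge in q0; nra.
Qed.

End Circle.

(** * One-dimensional complexes without circles *)

Section Complex.
Context {R : realType} {T : topologicalType} (hT : hausdorff_space T).
Context {n : nat} (K : {set {set 'I_n}}) (cK : simplicial_complex K)
  (dK : complex_dim K = 1%N).
Context (h : T -> 'rV[R]_n) (k : 'rV[R]_n -> T) (ch : continuous h)
  (ck : {within geometric_carrier R K, continuous k})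
  (hGC : forall y, geometric_carrier R K (h y)) (hK : cancel h k)
  (kK : forall x, geometric_carrier R K x -> h (k x) = x).
Implicit Types (V : {set 'I_n}) (u v w : 'I_n) (t : R).

Definition supp (x : 'rV[R]_n) := [set i | x 0 i != 0]%SET.

(** The full subcomplex spanned by the vertices in [V], pulled back to [T]. *)
Let XV V : set T := [set y | supp (h y) \subset V].

Let suppK y : supp (h y) \in K. Proof. by case: (hGC y). Qed.

Let supp_neq0 y : supp (h y) != finset.set0.
Proof. by case: cK => K0 _ _; exact: K0. Qed.

Let supp_card y : (#|supp (h y)| <= 2)%N.
Proof.
have : (#|supp (h y)|.-1 <= complex_dim K)%N by exact: leq_bigmax_cond.
by rewrite dK; case: #|_|.
Qed.

Let in_carrier (x : 'rV[R]_n) s : s \in K -> (forall i, 0 <= x 0 i) ->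
  \sum_i x 0 i = 1 -> supp x \subset s -> geometric_carrier R K x.
Proof.
move=> sK x0 x1 xs; split=> //; case: cK => _ _ sub; apply: (sub s) => //.
apply/negP => /eqP e; move: x1; rewrite big1 => [/eqP|i _].
  by rewrite eq_sym oner_eq0.
have : i \notin supp x by rewrite /supp e inE.
by rewrite inE negbK => /eqP.
Qed.

Lemma carrier_part_closed V : closed (XV V).
Proof.
rewrite (_ : XV V =
    \bigcap_(i in [set i | i \notin V]) [set y | h y 0 i = 0]); last first.
  apply/seteqP; split=> y /=.
    move=> /fintype.subsetP sV i /= iV; apply/eqP; apply: contraNT iV => hi.
    by apply: sV; rewrite inE.
  move=> yV; apply/fintype.subsetP => i; rewrite inE; apply: contraNT => iV.
  by rewrite yV.
apply: closed_bigI => i _.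
apply: (@closed_comp _ _ (fun y => h y 0 i) [set 0]); last exact: closed_eq.
move=> y _; apply: (@continuous_comp _ _ _ h (fun x : 'rV[R]_n => x 0 i)).
  exact: ch.
exact: coord_continuous.
Qed.

Let pt v := k (delta_mx 0 v).

Let delta_carrier v : geometric_carrier R K (delta_mx 0 v).
Proof.
apply: (@in_carrier _ [set v]%SET).
- by case: cK => _ K1 _; exact: K1.
- by move=> i; rewrite mxE ler0n.
- rewrite (bigD1 v)//= big1 ?addr0 ?mxE ?eqxx// => i iv.
  by rewrite mxE (negPf iv) andbF.
- apply/fintype.subsetP => i; rewrite !inE mxE /=.
  by case: (i == v); rewrite ?eqxx.
Qed.

Let h_pt v : h (pt v) = delta_mx 0 v. Proof. exact: kK. Qed.

Let supp_delta v : supp (delta_mx 0 v) = [set v]%SET.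
Proof. by apply/setP => i; rewrite !inE mxE; case: (i == v); rewrite ?oner_eq0 ?eqxx. Qed.

Let XV1 v : XV [set v]%SET = [set pt v].
Proof.
apply/seteqP; split=> y /=; last first.
  by move=> ->; rewrite /XV /= h_pt supp_delta.
move=> /fintype.subsetP sv; rewrite -[y]hK; congr k.
have [_ s1 _] := hGC y.
have h0 i : i != v -> h y 0 i = 0.
  by move=> iv; apply/eqP; apply: contraNT iv => hi;
    have := sv i; rewrite !inE; exact.
apply/rowP => i; rewrite mxE /=; case: eqVneq => [->|/h0 //].
by rewrite -s1 (bigD1 v)//= big1 ?addr0// => j /h0.
Qed.

Let seg u v t : 'rV[R]_n := (1 - t) *: delta_mx 0 u + t *: delta_mx 0 v.

Let segE u v t i : u != v ->
  seg u v t 0 i = if i == u then 1 - t else if i == v then t else 0.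
Proof.
move=> uv; rewrite !mxE /=; have [->|iu] := eqVneq i u.
  by rewrite (negPf uv) mulr1 mulr0 addr0.
by case: eqVneq; rewrite ?mulr1 ?mulr0 ?add0r.
Qed.

Let seg_carrier u v t : u != v -> [set u; v]%SET \in K -> t \in `[0, 1] ->
  geometric_carrier R K (seg u v t) /\ supp (seg u v t) \subset [set u; v]%SET.
Proof.
move=> uv uvK; rewrite in_itv/= => /andP[t0 t1].
have suv : supp (seg u v t) \subset [set u; v]%SET.
  apply/fintype.subsetP => i; rewrite !inE segE//.
  by case: (eqVneq i u) => //= _; case: (eqVneq i v) => //= _; rewrite eqxx.
split=> //; apply: (in_carrier uvK) => //.
- by move=> i; rewrite segE//; case: ifP => _; [lra|case: ifP].
- rewrite (bigD1 u)//= (bigD1 v)/=; last by rewrite eq_sym.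
  rewrite big1 ?addr0 ?segE// ?eqxx.
    by rewrite eq_sym (negPf uv) subrK.
  by move=> i /andP[iu iv]; rewrite segE// (negPf iu) (negPf iv).
Qed.

Lemma edge_arc u v : u != v -> [set u; v]%SET \in K ->
  exists g : R -> T, [/\ arc_param g 0 1, g 0 = pt u, g 1 = pt v &
    g @` `[0, 1] = XV [set u; v]%SET].
Proof.
move=> uv uvK; exists (fun t => k (seg u v t)); split.
- split.
    have cs : continuous (seg u v).
      move=> t; apply: cvgD.
        apply: cvgZr_tmp; apply: cvgB; [exact: cvg_cst|exact: cvg_id].
      by apply: cvgZr_tmp; exact: cvg_id.
    have csw := continuous_subspaceT (A := [set` `[0, 1 : R]]) cs.
    apply: (within_comp csw ck) => t /= t01.
    by have [] := seg_carrier uv uvK t01.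
  move=> s t s01 t01 e.
  have [cs _] := seg_carrier uv uvK s01; have [ct _] := seg_carrier uv uvK t01.
  have : seg u v s 0 v = seg u v t 0 v by rewrite -(kK cs) -(kK ct) e.
  by rewrite !segE// eq_sym (negPf uv) eqxx.
- by rewrite /pt /seg subr0 scale1r scale0r addr0.
- by rewrite /pt /seg subrr scale1r scale0r add0r.
- apply/seteqP; split=> y /=.
    move=> [t t01 <-]; have [ct st] := seg_carrier uv uvK t01.
    by rewrite /XV /= kK.
  move=> /fintype.subsetP suv; have [y0 y1 _] := hGC y.
  have out i : i != u -> i != v -> h y 0 i = 0.
    move=> iu iv; apply/eqP; apply: contraT => hi.
    by have := suv i; rewrite !inE (negPf iu) (negPf iv) => /(_ hi).
  have sum2 : h y 0 u + h y 0 v = 1.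
    rewrite -y1 (bigD1 u)//= (bigD1 v)/=; last by rewrite eq_sym.
    by rewrite big1 ?addr0// => i /andP[/out]; exact.
  exists (h y 0 v).
    by rewrite in_itv/= y0/= -sum2 lerDr.
  rewrite -[RHS]hK; congr k; apply/rowP => i; rewrite segE//.
  case: eqVneq => [->|iu]; first by rewrite -sum2 addrK.
  by case: eqVneq => [->//|iv]; rewrite out.
Qed.

Let XVI V W : XV V `&` XV W = XV (V :&: W)%SET.
Proof.
apply/seteqP; split=> y /=; rewrite /XV /=.
  by move=> [? ?]; rewrite finset.subsetI; apply/andP.
by rewrite finset.subsetI => /andP.
Qed.

Context (cT : connected [set: T])
  (noS : ~ exists S : set T, homeomorphic S (unit_circle R)).

(** Without a crossing edge every point would have its support in [V] or in the complement of [V],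
    and the two full subcomplexes would split the connected space [T] into disjoint nonempty closed
    sets. *)
Lemma crossing_edge V : V != finset.set0 -> V != finset.setT ->
  exists u v, [/\ u \in V, v \notin V & [set u; v]%SET \in K].
Proof.
move=> /finset.set0Pn[u0 u0V] VT; have [v0 v0V] : exists v, v \notin V.
  apply: contrapT => nov; case/eqP: VT; apply/setP => v; rewrite inE.
  by apply: contrapT => /negP vV; apply: nov; exists v.
apply: contrapT => noedge.
have [|||y [_ [yV yV']]] := connected_meet_closedI cT
  (@carrier_part_closed V) (@carrier_part_closed (~: V)%SET).
- move=> y _; have [yV|yV] := boolP (supp (h y) \subset V); first by left.
  right; apply/fintype.subsetP => u yu; rewrite inE; apply/negP => uV.
  case/fintype.subsetPn: yV => v yv vV; apply: noedge; exists u, v; split=> //.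
  suff -> : [set u; v]%SET = supp (h y) by [].
  apply/eqP; rewrite eqEcard; apply/andP; split.
    by apply/fintype.subsetP => i; rewrite !inE => /orP[] /eqP ->;
      move: yu yv; rewrite !inE.
  rewrite cards2; apply: leq_trans (supp_card y) _.
  by case: eqVneq => // uv; move: vV; rewrite -uv uV.
- by exists (pt u0); split=> //; rewrite /XV /= h_pt supp_delta finset.sub1set.
- by exists (pt v0); split=> //; rewrite /XV /= h_pt supp_delta finset.sub1set inE.
have /finset.set0Pn[i iy] := supp_neq0 y.
have := fintype.subsetP yV' _ iy.
by rewrite inE (fintype.subsetP yV _ iy).
Qed.

(** Two edges from [v] to distinct vertices [u] and [w] of [V] form an arc which, together with the
    arc from [u] to [w] inside [V], closes up to a circle. *)
Lemma unique_neighbour V u w v : tree_like R (XV V) -> u \in V -> w \in V ->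
  v \notin V -> [set u; v]%SET \in K -> [set w; v]%SET \in K -> u = w.
Proof.
move=> [_ _ aV _] uV wV vV uvK wvK; apply: contrapT => uw; apply: noS.
have vu : v != u by apply: contraNneq vV => ->.
have vw : v != w by apply: contraNneq vV => ->.
have ptV i : i \in V -> XV V (pt i).
  by move=> iV; rewrite /XV /= h_pt supp_delta finset.sub1set.
have ptuw : pt u <> pt w.
  move=> e; have := congr1 supp (congr1 h e); rewrite !h_pt !supp_delta.
  by move/setP/(_ u); rewrite !inE eqxx => /esym/eqP.
have [J Juw JV] := aV _ _ (ptV _ uV) (ptV _ wV) ptuw.
have [||g1 [gp1 g10 g11 gX1]] := @edge_arc u v; rewrite 1?eq_sym//.
have [||g2 [gp2 g20 g21 gX2]] := @edge_arc w v; rewrite 1?eq_sym//.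
have J1 : is_arc R (XV [set u; v]%SET) (pt u) (pt v) by exists g1.
have J2 : is_arc R (XV [set w; v]%SET) (pt w) (pt v) by exists g2.
have J12 : is_arc R (XV [set u; v]%SET `|` XV [set w; v]%SET) (pt u) (pt w).
  apply: (is_arc_cat hT J1 (is_arc_sym J2)); rewrite XVI -XV1; congr XV.
  apply/setP => i; rewrite !inE; case: (eqVneq i v) => [->|iv].
    by rewrite !orbT.
  by rewrite !orbF; case: eqVneq => // ->; apply/eqP.
apply: (arcs_circle hT Juw J12).
have meet i : i \in V -> XV V `&` XV [set i; v]%SET = [set pt i].
  move=> iV; rewrite XVI -XV1; congr XV; apply/setP => j; rewrite !inE.
  case: (eqVneq j i) => [->|ji]; first by rewrite iV.
  by rewrite orFb; case: (eqVneq j v) => [->|_]; rewrite ?andbF ?(negPf vV).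
apply/seteqP; split=> y.
  move=> [/JV[Vy _] [uy|wy]].
    have : (XV V `&` XV [set u; v]%SET) y by [].
    by rewrite meet// => ->; left.
  have : (XV V `&` XV [set w; v]%SET) y by [].
  by rewrite meet// => ->; right.
move=> [->|->]; split.
- exact: is_arc_l Juw.
- exact: is_arc_l J12.
- exact: is_arc_r Juw.
- exact: is_arc_r J12.
Qed.

(** The tree is built one vertex at a time: a crossing edge supplies a new vertex, and its neighbour
    being unique, the enlarged subcomplex is the old one with one arc attached at one point. *)
Lemma carrier_tree_like (y : T) : tree_like R [set: T].
Proof.
have Vgrow (m : nat) : (0 < m <= n)%N ->
    exists V : {set 'I_n}, #|V| = m /\ tree_like R (XV V).
  elim: m => // -[_ /andP[_ n0]|m IH /andP[_ mn]].
    exists [set Ordinal n0]%SET; rewrite cards1; split=> //.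
    by rewrite XV1; exact: tree_like1.
  have [|V [cV tV]] := IH; first exact: ltnW.
  have [||u [v [uV vV uvK]]] := @crossing_edge V.
  - by rewrite -card_gt0 cV.
  - by apply: contraTneq mn => VT; rewrite -leqNgt -cV VT cardsT card_ord.
  have vu : v != u by apply: contraNneq vV => ->.
  exists (v |: V)%SET; split; first by rewrite cardsU1 vV cV.
  have [||g [gp g0 g1 gX]] := @edge_arc u v; rewrite 1?eq_sym//.
  have XVu : XV V `&` XV [set u; v]%SET = [set pt u].
    rewrite XVI -XV1; congr XV; apply/setP => i; rewrite !inE.
    case: (eqVneq i u) => [->|iu]; first by rewrite uV.
    by rewrite orFb; case: (eqVneq i v) => [->|]; rewrite ?(negPf vV) ?andbF.
  (* A point with [v] in its support that is not the vertex itself lies on an edge from [v] to [V],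
     hence on the edge to [u]. *)
  have -> : XV (v |: V)%SET = XV V `|` XV [set u; v]%SET.
    apply/seteqP; split=> z; rewrite /XV /=; last first.
      case=> /fintype.subset_trans; apply; first exact: finset.subsetUr.
      by apply/fintype.subsetP => i; rewrite !inE => /orP[] /eqP ->;
        rewrite ?uV ?eqxx ?orbT.
    move=> yvV; have [vz|vz] := boolP (v \in supp (h z)); last first.
      left; apply/fintype.subsetP => i iz.
      have := fintype.subsetP yvV i iz; rewrite !inE => /orP[/eqP iv|//].
      by rewrite -iv iz in vz.
    right; apply/fintype.subsetP => i iz; rewrite !inE.
    have [->|iv] := eqVneq i v; first by rewrite orbT.
    have := fintype.subsetP yvV i iz; rewrite !inE (negPf iv) /= => iV.
    rewrite orbF; apply/eqP; apply: (unique_neighbour tV iV uV vV _ uvK).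
    suff -> : [set i; v]%SET = supp (h z) by [].
    apply/eqP; rewrite eqEcard; apply/andP; split.
      by apply/fintype.subsetP => j; rewrite !inE => /orP[] /eqP ->;
        move: iz vz; rewrite !inE.
    by rewrite cards2 iv; exact: supp_card.
  exact: (wedge_tree_like hT (@carrier_part_closed V) gp g0 gX XVu).
have /finset.set0Pn[i _] := supp_neq0 y.
have [|V [cV tV]] := Vgrow n; first by rewrite (leq_ltn_trans _ (ltn_ord i))/=.
have VT : V = finset.setT.
  by apply/eqP; rewrite eqEcard finset.subsetT cardsT card_ord cV /=.
suff <- : XV V = setT by [].
by apply/seteqP; split=> // z _; rewrite /XV /= VT finset.subsetT.
Qed.

End Complex.

Lemma topological_tree_like (R : realType) (T : metricType R) :
  topological_tree T -> tree_like R [set: T].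
Proof.
move=> [[[[y _] _ cT] [n [K [cK dK [h [k [ch ck hT kT [hk kh]]]]]]]] noS].
have GCh x : geometric_carrier R K (h x) by rewrite -hT; exists x.
apply: (@carrier_tree_like _ _ (@metric_hausdorff _ T) _ K cK dK h k) => //.
- exact/continuous_subspace_setT.
- by move=> x; apply: hk; rewrite inE.
- by move=> x Gx; apply: kh; rewrite inE.
Qed.

(** * The orders of a tree *)

Section Hulls.
Context {R : realType} {T : topologicalType} (hT : hausdorff_space T)
  (tT : tree_like R [set: T]).
Implicit Types (a b c p x y : T) (A C E U : set T).

Definition hull a b : set T := hull_in [set: T] a b.

Lemma hull_min a b C : connected C -> C a -> C b -> hull a b `<=` C.
Proof. by move=> cC Ca Cb; exact: hull_in_sub. Qed.

Lemma hullC a b : hull a b = hull b a. Proof. exact: hull_in_sym. Qed.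

Lemma hull_l a b : hull a b a. Proof. by []. Qed.

Lemma hull_r a b : hull a b b. Proof. by []. Qed.

Lemma hullxx a : hull a a = [set a].
Proof.
apply/seteqP; split=> [|x ->//].
by apply: hull_min => //; exact: connected1.
Qed.

Lemma hull_arc a b : a <> b -> is_arc R (hull a b) a b.
Proof.
case: tT => _ _ aT _ /(aT a b I I)[J Jab JT].
suff -> : hull a b = J by [].
apply/seteqP; split; last by move=> x /JT[].
by apply: hull_min; [exact: is_arc_connected Jab|exact: is_arc_l Jab|
  exact: is_arc_r Jab].
Qed.

Lemma hull_connected a b : connected (hull a b).
Proof.
have [->|/eqP/hull_arc] := eqVneq a b; last exact: is_arc_connected.
by rewrite hullxx; exact: connected1.
Qed.

Lemma hull_closed a b : closed (hull a b).
Proof.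
have [->|/eqP/hull_arc] := eqVneq a b; last exact: is_arc_closed.
rewrite hullxx; apply: accessible_closed_set1; exact: hausdorff_accessible.
Qed.

Lemma hull_sub p x y : hull p y x -> hull p x `<=` hull p y.
Proof. by move=> h; apply: hull_min => //; exact: hull_connected. Qed.

(** Write [x] as [g s] on the arc from [p] to [y]. The piece up to [s] is connected, so it contains
    [y], the value at 1; injectivity forces [s = 1]. *)
Lemma hull_anti p x y : hull p y x -> hull p x y -> x = y.
Proof.
have [->|/eqP/hull_arc[g [gp g0 g1 gh]]] := eqVneq p y; first by rewrite hullxx.
rewrite -{1}gh => -[s /= s01 gs].
have gs0 : (g @` [set` `[0, s]]) y -> x = y.
  move=> [t /= t0s gt]; move: s01 t0s; rewrite !in_itv/= => /andP[s0 s1].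
  move=> /andP[t0 ts]; have t1 : t = 1.
    by apply: gp.2; rewrite ?gt ?g1// in_itv/=; apply/andP; split=> //; lra.
  have s1' : s = 1 by lra.
  by rewrite -gs -gt s1' t1.
move: (s01); rewrite in_itv/= => /andP[s0 s1] hy; apply: gs0; apply: hy => //.
- by apply: arc_param_connected; apply: arc_param_sub gp.
- by exists 0 => //=; rewrite in_itv/= lexx.
- by exists s => //=; rewrite in_itv/= lexx andbT.
Qed.

(** With any two of its points the intersection contains their hull, which is connected. *)
Lemma connectedI C E : connected C -> connected E -> connected (C `&` E).
Proof.
move=> cC cE; apply: connected_pairwise => x y [Cx Ex] [Cy Ey].
exists (hull x y); split=> //; last exact: hull_connected.
by move=> z hz; split; [apply: hull_min hz|apply: hull_min hz].
Qed.

Lemma connected_nbhs a U : nbhs a U ->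
  exists N, [/\ N `<=` U, connected N & nbhs a N].
Proof.
case: tT => _ lT _ _ aU; have [N [V [NU cN aV VN]]] := lT a U I aU.
exists N; split=> // [x /NU[]//|]; apply: filterS aV => x Vx; exact: VN.
Qed.

(** The order of root [p] is a closed relation: for [y'] in a small connected neighbourhood [N] of
    [y], the hull of [p] and [y'] stays in the union of [N] and the hull of [p] and [y]. *)
Lemma hull_notin_near p x y : ~ hull p y x ->
  exists U V, [/\ nbhs x U, nbhs y V & forall x' y', U x' -> V y' -> ~ hull p y' x'].
Proof.
move=> nx; have xy : x <> y by move=> e; apply: nx; rewrite e.
have [A [B [Ax By_ AB]]] : exists A B : set T,
    [/\ nbhs x A, nbhs y B & A `&` B = set0].
  apply: contrapT => noAB; apply: xy; apply: hT => A B Ax By_.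
  by apply/set0P/eqP => AB; apply: noAB; exists A, B.
have [N [NB cN yN]] := connected_nbhs By_.
exists (A `&` ~` hull p y), N; split=> //.
  apply: filterI => //; apply: open_nbhs_nbhs; split=> //.
  by apply: closed_openC; apply: hull_closed.
move=> x' y' [Ax' nx'] Ny' hx'.
have : (hull p y `|` N) x'.
  apply: hull_min hx'; [|by left|by right].
  apply: connectedU => //; last exact: hull_connected.
  by exists y; split; [exact: hull_r|exact: nbhs_singleton].
case=> [//|Nx'].
by have : (A `&` B) x' by [split=> //; exact: NB]; rewrite AB.
Qed.

(** Take [x] strictly between [a] and [b], and connected neighbourhoods of [a] and [b] avoiding it.
    A connected [C] meeting both interiors forms with them a connected set through [a] and [b]; that
    set contains [x], so [C] does. *)
Lemma separating_point a b : a <> b -> exists x (U V : set T),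
  [/\ open U, open V, U a, V b &
    forall C, connected C -> C `&` U !=set0 -> C `&` V !=set0 -> C x].
Proof.
have T1 := hausdorff_accessible hT => ab.
have oC c z : c <> z -> nbhs z (~` [set c]).
  move=> cz; apply: open_nbhs_nbhs; split; last by move=> /esym.
  exact/closed_openC/accessible_closed_set1.
have [x [hx xb xa]] := @connected_nbhs_neq _ (hull a b) (~` [set b]) a b T1
  (@hull_connected a b) (@hull_l a b) (@hull_r a b) ab (oC b a (fun e => ab (esym e))).
have [N [Nx cN aN]] := connected_nbhs (oC x a xa).
have [M [Mx cM bM]] := connected_nbhs (oC x b xb).
exists x, N°, M°; split; try exact: open_interior.
- exact: aN.
- exact: bM.
move=> C cC [u [Cu /nbhs_singleton Nu]] [v [Cv /nbhs_singleton Mv]].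
have : (N `|` C `|` M) x.
  apply: hull_min hx.
  - apply: connectedU => //; first by exists v; split=> //; right.
    by apply: connectedU => //; exists u.
  - by left; left; exact: nbhs_singleton.
  - by right; exact: nbhs_singleton.
by move=> [[/Nx /(_ erefl)|//]|/Mx /(_ erefl)].
Qed.

Lemma hull_width : exists r, forall c, exists kappa : T -> 'I_r.+1,
  forall x y, kappa x = kappa y -> hull c x y \/ hull c y x.
Proof.
case: tT => _ _ _ [r wr]; exists r => c; have [k [kr kc]] := wr c I.
exists (fun x => inord (k x)) => x y /(congr1 val) /=.
by rewrite !inordK; [exact: kc|rewrite ltnW// ltnS; exact: kr..].
Qed.

End Hulls.
Arguments hull_l {T} a b.
Arguments hull_r {T} a b.
Arguments hull_connected {R T} tT a b.
Arguments hull_closed {R T} hT tT a b.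

(** * Maximal points and gates *)

Section TreeMaps.
Context {R : realType} {T : topologicalType} (hT : hausdorff_space T)
  (tT : tree_like R [set: T]).
Implicit Types (a c p x y z : T) (S Y : set T) (f : T -> T).

(** By Zorn's lemma: the sets of points of [S] above the members of a chain generate a filter, and
    since the order is closed, a cluster point of it bounds the chain. *)
Lemma hull_maximal S p x0 : compact S -> S x0 ->
  exists m, [/\ S m, hull p m x0 & forall z, S z -> hull p z m -> z = m].
Proof.
move=> cS Sx0; pose Q := {z : T | S z /\ hull p z x0}.
have [|||C totC|[m [Sm mx0]] max] :=
    @Zorn Q (fun u v => `[< hull p (sval v) (sval u) >]).
- by move=> u; apply/asboolP; exact: hull_r.
- move=> u v w /asboolP uv /asboolP vw; apply/asboolP.
  exact: (hull_sub tT vw uv).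
- move=> [u Pu] [v Pv] /asboolP /= uv /asboolP /= vu.
  have e : u = v by exact: (hull_anti tT uv vu).
  by move: Pu Pv; rewrite e => Pu Pv; congr exist; exact: Prop_irrelevance.
- have [[s0 Cs0]|C0] := pselect (exists s, C s); last first.
    exists (exist _ x0 (conj Sx0 (@hull_r _ p x0))) => s Cs.
    by exfalso; apply: C0; exists s.
  pose B (s : Q) := [set z | S z /\ hull p z (sval s)].
  pose F := filter_from C B.
  have FF : ProperFilter F.
    apply: filter_from_proper; last first.
      by move=> [s [Ss sx]] _; exists s; split=> //; exact: hull_r.
    apply: filter_from_filter; first by exists s0.
    move=> s t Cs Ct; case: (totC s t Cs Ct) => /asboolP st.
      exists t => // z [Sz zt]; split; split=> //.
      exact: (hull_sub tT zt st).
    exists s => // z [Sz zs]; split; split=> //.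
    exact: (hull_sub tT zs st).
  have FS : F S by exists s0 => // z [].
  have [z [Sz clz]] := cS F FF FS.
  have zC s : C s -> hull p z (sval s).
    move=> Cs; apply: contrapT => nzs.
    have [U [V [Us Vz UV]]] := hull_notin_near hT tT nzs.
    have [y [[_ ys] Vy]] := clz (B s) V (ex_intro2 _ _ s Cs (fun _ h => h)) Vz.
    by apply: (UV _ _ (nbhs_singleton Us) Vy).
  have zx0 : hull p z x0.
    exact: (hull_sub tT (zC s0 Cs0) (proj2 (svalP s0))).
  by exists (exist _ z (conj Sz zx0)) => s Cs; apply/asboolP; exact: zC.
exists m; split=> // z Sz zm.
have zx0 : hull p z x0 by exact: (hull_sub tT zm mx0).
have /(_ _)/(congr1 sval) := max (exist _ z (conj Sz zx0)).
by apply; apply/asboolP.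
Qed.

(* With f composed with the retraction onto Y, this is the fixed point
   property of Y; x is maximal among the points of Y that f moves away
   from a. *)
Lemma gate_fixed_point f Y : continuous f -> compact Y -> connected Y ->
  Y !=set0 -> exists2 x, Y x & forall y, Y y -> hull (f x) y x.
Proof.
move=> cf cY coY [a Ya]; have T1 := hausdorff_accessible hT.
pose S := Y `&` [set x | hull a (f x) x].
have clS : closed [set x | hull a (f x) x].
  rewrite -[X in closed X]setCK; apply: open_closedC.
  rewrite openE => x /= nx.
  have [U [V [xU fxV UV]]] := hull_notin_near hT tT nx.
  have fV : nbhs x (f @^-1` V) by exact: cf.
  rewrite /interior; near=> z; apply: UV; near: z => //.
have cS : compact S by exact: compact_closedI.
have Sa : S a by split=> //; exact: hull_l.
have [x [[Yx xfx] _ max]] := @hull_maximal S a a cS Sa.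
exists x => // y' Yy'; apply: contrapT => nx.
have fx : f x <> x by move=> e; apply: nx; rewrite e; exact: hull_l.
(* If [x] is not the gate, the arc from [x] to [f x] starts inside [Y]. A point [y] of it close to
   [x] is still in [S], by continuity of [f], and lies strictly above [x]. *)
pose E := hull x (f x) `&` Y.
have cE : connected E by apply: (connectedI tT) => //; exact: (hull_connected tT).
have Ex : E x by split=> //; exact: hull_l.
(* Were [x] the only point of [E], the hull of [f x] and [y'] would have to pass through [x],
   against the choice of [y']. *)
have [x1 [Ex1 x1x]] : exists x1, E x1 /\ x1 <> x.
  apply: contrapT => noE; apply: nx.
  have [|||z [hz [h1 Yz]]] := @connected_meet_closedI _ (hull (f x) y')
      (hull x (f x)) Y (hull_connected tT _ _) (hull_closed hT tT _ _)
      (compact_closed hT cY).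
  - apply: hull_min; [|by left; exact: hull_r|by right].
    apply: connectedU; [|exact: (hull_connected tT)|by []].
    by exists x; split=> //; exact: hull_l.
  - by exists (f x); split; [exact: hull_l|exact: hull_r].
  - by exists y'; split; [exact: hull_r|].
  have [zx|/eqP zx] := eqVneq z x; first by rewrite zx in hz.
  by exfalso; apply: noE; exists z.
have [A [B [Ax Bfx AB]]] : exists A B : set T,
    [/\ nbhs x A, nbhs (f x) B & A `&` B = set0].
  apply: contrapT => noAB; apply: fx; apply/esym; apply: hT => A B Ax By_.
  by apply/set0P/eqP => AB; apply: noAB; exists A, B.
have [N [NB cN Nfx]] := connected_nbhs tT Bfx.
have [y [[xfxy Yy] [Ay Nfy] yx]] : exists y, [/\ E y, (A `&` f @^-1` N) y & y <> x].
  apply: (connected_nbhs_neq T1 cE Ex Ex1 (fun e => x1x (esym e))).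
  by apply: filterI => //; exact: cf.
have sub : hull x (f x) `<=` hull a (f x).
  by apply: hull_min => //; exact: (hull_connected tT).
have yS : S y.
  split=> //; have : (hull a (f y) `|` N) y.
    apply: (hull_min _ _ _ (sub _ xfxy)).
    - apply: connectedU => //; last exact: (hull_connected tT).
      by exists (f y); split=> //; exact: hull_r.
    - by left; exact: hull_l.
    - by right; exact: nbhs_singleton.
  by case=> // /NB By; have : (A `&` B) y by []; rewrite AB.
apply: yx; apply: max => //.
have : (hull a y `|` hull y (f x)) x.
  apply: (hull_min _ _ _ xfx).
  - apply: connectedU; try exact: (hull_connected tT).
    by exists y; split; [exact: hull_r|exact: hull_l].
  - by left; exact: hull_l.
  - by right; exact: hull_r.
case=> // yfx; suff -> : x = y by exact: hull_r.
by apply: (hull_anti tT (p := f x)); rewrite hullC.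
Unshelve. all: by end_near. Qed.

End TreeMaps.

(** * Recurrence in the hyperspace *)

Section Recurrence.
Context {X : topologicalType}.
Implicit Types (g : X -> X) (x : X) (U : set X).

Lemma RecP g x : Rec g x <->
  forall U N, nbhs x U -> exists2 n, (N <= n)%N & U (iter n g x).
Proof.
split=> [rx U N xU|rx A B [N _ NA] xB].
  have [|y [[n /= Nn <-] Uy]] := rx [set iter n g x | n in [set n | (N <= n)%N]] U _ xU.
    by exists N => // n /= Nn; exists n.
  by exists n.
by have [n Nn Bn] := rx B N xB; exists (iter n g x); split=> //; exact: NA.
Qed.

Context (g : X -> X) (cg : continuous g).

Lemma continuous_iter n : continuous (iter n g).
Proof.
elim: n => [|n IH] x; first exact: cvg_id.
by apply: (@continuous_comp _ _ _ (iter n g) g); [exact: IH|exact: cg].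
Qed.

(* The residues mod q of the return times of x to its neighbourhoods form a
   set closed under addition, hence contain 0. *)
Lemma Rec_iter q x : (0 < q)%N -> Rec g x -> Rec (iter q g) x.
Proof.
move=> q0 /RecP rx.
pose r j := forall U N, nbhs x U ->
  exists n, [/\ (N <= n)%N, (n = j %[mod q])%N & U (iter n g x)].
have rD i j : r i -> r j -> r (i + j)%N.
  move=> ri rj U N /nbhs_interior xU.
  have [n [Nn ni Un]] := ri U° N xU.
  have xV : nbhs x (iter n g @^-1` U°).
    apply: (@continuous_iter n x); apply: open_nbhs_nbhs; split=> //.
    exact: open_interior.
  have [m [Nm mj Vm]] := rj _ N xV.
  exists (n + m)%N; split.
  - by apply: leq_trans Nn _; exact: leq_addr.
  - by rewrite -modnDm ni mj modnDm.
  - by rewrite iterD; exact: nbhs_singleton.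
have [j rj] : exists j : 'I_q, r j.
  apply: contrapT => nor.
  have /choice[V hV] (j : 'I_q) : exists UN : set X * nat, nbhs x UN.1 /\
      forall n, (UN.2 <= n)%N -> (n = j %[mod q])%N -> ~ UN.1 (iter n g x).
    apply: contrapT => noUN; apply: nor; exists j => U N xU.
    apply: contrapT => non; apply: noUN; exists (U, N); split=> // n Nn nj Un.
    by apply: non; exists n.
  have xU : nbhs x [set y | forall j : 'I_q, (V j).1 y].
    by apply: filter_forall => j; case: (hV j).
  have [n Nn Un] := rx _ (\max_(j < q) (V j).2)%N xU.
  have [_] := hV (Ordinal (ltn_pmod n q0)); move=> /(_ n); apply => //.
  - by apply: leq_trans Nn; exact: (leq_bigmax (Ordinal (ltn_pmod n q0))).
  - by rewrite /= modn_mod.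
have rjm m : r (m.+1 * j)%N.
  by elim: m => [|m IH]; rewrite ?mul1n// mulSn; exact: rD.
apply/RecP => U N xU; have [n [Nn nq Un]] := rjm q.-1 U (N * q)%N xU.
move: nq; rewrite prednK// modnMr => nq.
have nE : n = (n %/ q * q)%N by rewrite divnK//; apply/eqP.
exists (n %/ q)%N; first by rewrite leq_divRL.
by rewrite -iterM -nE.
Qed.

Lemma Rec_image m x : Rec g x -> Rec g (iter m g x).
Proof.
move=> /RecP rx; apply/RecP => U N xU.
have [n Nn Un] := rx (iter m g @^-1` U) N (@continuous_iter m x _ xU).
by exists n => //; rewrite -iterD addnC iterD.
Qed.

End Recurrence.

Section Hyperspace.
Context {R : realType} {T : metricType R} (cT : compact [set: T]).
Implicit Types (A B D : subcontinuum T) (U : set T).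

Lemma mdist_continuous : continuous (fun p : T * T => mdist p.1 p.2 : R).
Proof.
move=> [x y]; apply/cvgrPdist_lt => e e0 /=.
have e2 : 0 < e / 2 by exact: divr_gt0.
exists (ball x (e / 2), ball y (e / 2)).
  by split; exact: nbhsx_ballx.
move=> [x' y'] [/= + +]; rewrite !ballEmdist/= => xx yy.
rewrite ltr_norml.
have h1 := metric_triangle x x' y; have h2 := metric_triangle x' y' y.
have h3 := metric_triangle x' x y'; have h4 := metric_triangle x y y'.
rewrite (metric_sym y' y) in h2; rewrite (metric_sym x' x) in h3.
by apply/andP; split; lra.
Qed.

Lemma mdist_bounded : exists M, forall x y : T, mdist x y <= M.
Proof.
have /compact_bounded[M [_ HM]] :
    compact [set (mdist p.1 p.2 : R) | p in [set: T] `*` [set: T]].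
  apply: compact_image; first exact: mdist_continuous.
  exact: compact_setX.
exists (M + 1) => x y; apply: le_trans (ler_norm _) _.
by apply: HM; [rewrite ltrDl|exists (x, y)].
Qed.

Lemma dist_to_ltP (B : set T) x e : B !=set0 ->
  dist_to B x < e <-> exists2 y, B y & mdist x y < e.
Proof.
move=> [b Bb]; split=> [|[y By xy]].
  move=> /inf_lt[|_ [y By <-] ?]; last by exists y.
  by exists (mdist x b), b.
apply: le_lt_trans xy; apply: ge_inf; last by exists y.
by exists 0 => _ [z _ <-]; exact: mdist_ge0.
Qed.

Lemma subcontinuum_neq0 A : (A : set T) !=set0.
Proof. by case: (subcontinuumP A). Qed.

Lemma subcontinuum_compact A : compact (A : set T).
Proof. by case: (subcontinuumP A). Qed.

Lemma subcontinuum_connected A : connected (A : set T).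
Proof. by case: (subcontinuumP A). Qed.

Lemma subcontinuum_closed A : closed (A : set T).
Proof.
apply: compact_closed; first exact: metric_hausdorff.
exact: subcontinuum_compact.
Qed.

Lemma hausdorff_distC (A B : set T) : hausdorff_dist A B = hausdorff_dist B A.
Proof. by rewrite /hausdorff_dist maxC. Qed.

Lemma hausdorff_dist_lt A B e x : hausdorff_dist A B < e -> (A : set T) x ->
  exists2 y, (B : set T) y & mdist x y < e.
Proof.
move=> ABe Ax; apply/dist_to_ltP; first exact: subcontinuum_neq0.
apply: le_lt_trans ABe; rewrite le_max; apply/orP; left.
apply: ub_le_sup; last by exists x.
have [M HM] := mdist_bounded; have [b Bb] := subcontinuum_neq0 B.
exists (M + 1) => _ [z Az <-]; apply: ltW; apply/dist_to_ltP; first by exists b.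
by exists b => //; apply: le_lt_trans (HM z b) _; rewrite ltrDl.
Qed.

Lemma hausdorff_dist_le A B e :
  (forall x, (A : set T) x -> exists2 y, (B : set T) y & mdist x y < e) ->
  (forall x, (B : set T) x -> exists2 y, (A : set T) y & mdist x y < e) ->
  hausdorff_dist A B <= e.
Proof.
have [a Aa] := subcontinuum_neq0 A; have [b Bb] := subcontinuum_neq0 B.
move=> hA hB; rewrite ge_max; apply/andP; split; apply: ge_sup.
- by exists (dist_to B a), a.
- move=> _ [x /hA xB <-]; apply: ltW; apply/dist_to_ltP => //.
  exact: subcontinuum_neq0.
- by exists (dist_to A b), b.
- move=> _ [x /hB xA <-]; apply: ltW; apply/dist_to_ltP => //.
  exact: subcontinuum_neq0.
Qed.

Lemma near_subcontinuum A (P : set (subcontinuum T)) : nbhs A P <->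
  exists2 e, 0 < e & forall D, hausdorff_dist A D < e -> P D.
Proof.
split=> [/nbhs_ballP[e /= e0 eP]|[e e0 eP]].
  by exists e => // D AD; apply: eP; rewrite ballEmdist/= mdist_subcontinuumE.
by apply/nbhs_ballP; exists e.
Qed.

(** This and [near_subset] give the two kinds of basic neighbourhoods of the Vietoris topology, the
    form in which recurrence in the hyperspace is mostly exploited. *)
Lemma near_meets A U : open U -> (A : set T) `&` U !=set0 ->
  \forall D \near A, subcontinuum_set D `&` U !=set0.
Proof.
move=> oU [x [Ax Ux]]; have /nbhs_ballP[e /= e0 eU] : nbhs x U.
  by apply: open_nbhs_nbhs.
apply/near_subcontinuum; exists e => // D /hausdorff_dist_lt /(_ Ax)[y Dy xy].
by exists y; split=> //; apply: eU; rewrite ballEmdist.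
Qed.

Lemma compact_uniform_nbhs (C U : set T) : compact C -> open U -> C `<=` U ->
  exists2 e, 0 < e & forall x y, C x -> mdist x y < e -> U y.
Proof.
move=> /compact_near_coveringP cC oU CU.
have : \forall e \near (0 : R)^'+, C `<=` [set x | forall y, mdist x y < e -> U y].
  apply: cC => x Cx; have /nbhs_ballP[e /= e0 eU] : nbhs x U.
    by apply: open_nbhs_nbhs; split=> //; exact: CU.
  exists (ball x (e / 2), [set d | d < e / 2]).
    split=> /=; first by apply: nbhsx_ballx; exact: divr_gt0.
    by apply: nbhs_right_lt; exact: divr_gt0.
  move=> [x' d] [/=]; rewrite ballEmdist/= => xx de y xy.
  apply: eU; rewrite ballEmdist/=.
  by have := metric_triangle x x' y; lra.
move=> hU; have [e [e0 heU]] : exists e, 0 < e /\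
    C `<=` [set x | forall y, mdist x y < e -> U y].
  by apply: (@filter_ex _ (0 : R)^'+); apply: filterI hU; exact: nbhs_right_gt.
by exists e => // x y /heU; exact.
Qed.

Lemma near_subset A U : open U -> (A : set T) `<=` U ->
  \forall D \near A, subcontinuum_set D `<=` U.
Proof.
move=> oU /(compact_uniform_nbhs (@subcontinuum_compact A) oU)[e e0 eU].
apply/near_subcontinuum; exists e => // D; rewrite hausdorff_distC => AD y Dy.
have [x Ax yx] := hausdorff_dist_lt AD Dy.
by apply: (eU x) => //; rewrite metric_sym.
Qed.

Context (f : T -> T) (cf : continuous f).

Lemma uniformly_continuous e : 0 < e ->
  exists2 d, 0 < d & forall x y, mdist x y < d -> mdist (f x) (f y) < e.
Proof.
move=> e0; move/compact_near_coveringP: (cT) => ncT.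
have : \forall d \near (0 : R)^'+, [set: T] `<=`
    [set x | forall y, mdist x y < d -> mdist (f x) (f y) < e].
  apply: ncT => x _; have e2 : 0 < e / 2 by exact: divr_gt0.
  have /nbhs_ballP[d /= d0 dU] : nbhs x (f @^-1` ball (f x) (e / 2)).
    by apply: cf; exact: nbhsx_ballx.
  exists (ball x (d / 2), [set d' | d' < d / 2]).
    split=> /=; first by apply: nbhsx_ballx; exact: divr_gt0.
    by apply: nbhs_right_lt; exact: divr_gt0.
  move=> [x' d'] [/=]; rewrite ballEmdist/= => xx dd y xy.
  have /dU : ball x d x' by rewrite ballEmdist/=; lra.
  have /dU : ball x d y.
    by rewrite ballEmdist/=; have := metric_triangle x x' y; lra.
  rewrite /= !ballEmdist/= => fy fx'.
  by have := metric_triangle (f x') (f x) (f y); rewrite (metric_sym (f x') (f x)); lra.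
move=> hU; have [d [d0 hd]] : exists d, 0 < d /\ [set: T] `<=`
    [set x | forall y, mdist x y < d -> mdist (f x) (f y) < e].
  by apply: (@filter_ex _ (0 : R)^'+); apply: filterI hU; exact: nbhs_right_gt.
by exists d => // x y; exact: hd.
Qed.

Lemma induced_map_continuous : continuous (induced_map cf).
Proof.
move=> A P /near_subcontinuum[e e0 eP].
have e2 : 0 < e / 2 by exact: divr_gt0.
have [d d0 hd] := uniformly_continuous e2.
apply/near_subcontinuum; exists d => // D AD; apply: eP.
apply: (@le_lt_trans _ _ (e / 2)); last by rewrite ltr_pdivrMr// ltr_pMr// ltr1n.
apply: hausdorff_dist_le => _ [x xAD <-].
  have [y Dy xy] := hausdorff_dist_lt AD xAD.
  by exists (f y); [exists y|exact: hd].
rewrite hausdorff_distC in AD; have [y Dy xy] := hausdorff_dist_lt AD xAD.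
by exists (f y); [exists y|exact: hd].
Qed.

Lemma iter_induced_mapE n A :
  (iter n (induced_map cf) A : set T) = iter n f @` A.
Proof.
elim: n => [|n IH]; first by rewrite image_id.
have -> : iter n.+1 f @` A = f @` (iter n f @` A) by rewrite image_comp.
by rewrite -IH.
Qed.

Lemma induced_map_iter n (cfn : continuous (iter n f)) :
  induced_map cfn = iter n (induced_map cf).
Proof.
by apply/funext => A; apply: subcontinuum_inj; rewrite iter_induced_mapE.
Qed.

End Hyperspace.

(** * Recurrent subcontinua *)

Section IteratedImages.
Context {T : topologicalType} (f : T -> T) (cf : continuous f).
Implicit Types (C D : set T) (c x y z : T).

Lemma image_iterD m n C : iter (m + n) f @` C = iter m f @` (iter n f @` C).
Proof. by rewrite image_comp; congr image; apply/funext => x; rewrite /= iterD. Qed.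

Lemma image_iter_mem m n C x :
  (iter n f @` C) x -> (iter (m + n) f @` C) (iter m f x).
Proof. by rewrite image_iterD => Cx; exists x. Qed.

Lemma connected_image_iter n C : connected C -> connected (iter n f @` C).
Proof. by apply: connected_image; exact: continuous_iter. Qed.

Lemma compact_image_iter n C : compact C -> compact (iter n f @` C).
Proof. by apply: compact_image; exact: continuous_iter. Qed.

End IteratedImages.

(** * Chains below a fixed point *)

Section FixedPointOrder.
Context {R : realType} {T : topologicalType} (hT : hausdorff_space T)
  (tT : tree_like R [set: T]) (f : T -> T) (cf : continuous f)
  (c : T) (fc : f c = c) (w : nat) (kappa : T -> 'I_w)
  (kappaP : forall x y, kappa x = kappa y -> hull c x y \/ hull c y x).
Implicit Types (C : set T) (x y z : T).

Lemma iter_fixed n : iter n f c = c.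
Proof. by elim: n => //= n ->. Qed.

Lemma hull_sub_image n C x : connected C -> C c -> (iter n f @` C) x ->
  hull c x `<=` iter n f @` C.
Proof.
move=> cC Cc Cx; apply: hull_min => //; first exact: connected_image_iter.
by exists c => //; exact: iter_fixed.
Qed.

(** The step relation of the chains, made boolean so that [path] applies to it. *)
Definition pulls x y : bool := `[< (f @` hull c x) y >].

Lemma pullsP x y : reflect ((iter 1 f @` hull c x) y) (pulls x y).
Proof. exact: asboolP. Qed.

(** As [c] is fixed, each step puts the whole hull of [c] and the next point into the image of the
    previous hull, so the inclusions compose. *)
Lemma pulls_path x s : path pulls x s ->
  (iter (size s) f @` hull c x) (last x s).
Proof.
elim: s x => [|y s IH] x; first by move=> _; exists x => //; exact: hull_r.
move=> /= /andP[/pullsP xy /IH ys].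
suff : (iter (size s).+1 f @` hull c x) (last y s) by [].
rewrite -addn1 image_iterD.
apply: image_subset ys.
exact: (hull_sub_image (hull_connected tT c x) (hull_l c x) xy).
Qed.

(** Pigeonhole on the first [w.+1] entries, which also bounds the gap between the two equal
    colours. *)
Lemma repeated_color (s : seq T) : (w < size s)%N ->
  exists s1 x s2 y s3, [/\ s = s1 ++ x :: s2 ++ y :: s3, kappa x = kappa y &
    (size s2 < w)%N].
Proof.
move=> ws; have x0 : T by case: s ws.
have /(uniqPn (kappa x0))[i [j [ij jw kij]]] : ~~ uniq (map kappa (take w.+1 s)).
  apply/negP => /card_uniqP u; have := max_card (mem (map kappa (take w.+1 s))).
  by rewrite u size_map size_takel// card_ord ltnn.
rewrite size_map size_takel// in jw.
have iw : (i < w.+1)%N by exact: ltn_trans jw.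
have js : (j < size s)%N by exact: leq_trans jw ws.
have is_ : (i < size s)%N by exact: ltn_trans js.
move: kij; rewrite !(nth_map x0) ?size_takel// !nth_take// => kij.
exists (take i s), (nth x0 s i), (take (j - i.+1) (drop i.+1 s)), (nth x0 s j),
  (drop j.+1 s); split=> //.
- rewrite -[LHS](cat_take_drop i) (drop_nth x0 is_); congr (_ ++ _ :: _).
  rewrite -[LHS](cat_take_drop (j - i.+1)); congr (_ ++ _).
  by rewrite drop_drop subnK// (drop_nth x0 js).
- rewrite size_takel ?size_drop ?leq_sub2r// ?(ltnW js)// ltn_subLR//.
  by apply: leq_trans jw _; rewrite addSn ltnS leq_addl.
Qed.

(* A shortest chain from x to its last point has at most w steps, unless some
   point of it is pulled back below itself in at most w steps. *)
Lemma pulls_shorten x s : path pulls x s -> s <> [::] ->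
  (exists z j, [/\ z \in s, (0 < j <= w)%N & (iter j f @` hull c z) z]) \/
  (exists2 k, (0 < k <= w)%N & (iter k f @` hull c x) (last x s)).
Proof.
have [m] := ubnP (size s); elim: m s => // m IH s; rewrite ltnS => sm ps s0.
have [sw|ws] := leqP (size s) w.
  right; exists (size s); last exact: pulls_path.
  by rewrite sw andbT; case: s s0 {sm ps sw}.
have [s1 [a [s2 [b [s3 [sE kab s2w]]]]]] := repeated_color ws.
move: (ps); rewrite sE cat_path /= cat_path /= => /and4P[ps1 xa ps2].
move=> /andP[ab ps3].
have aab : (iter (size s2).+1 f @` hull c a) b.
  have -> : (size s2).+1 = size (rcons s2 b) by rewrite size_rcons.
  have {2}-> : b = last a (rcons s2 b) by rewrite last_rcons.
  by apply: pulls_path; rewrite rcons_path ps2.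
(* If [a] is below [b], the chain from [a] to [b] pulls [a] back into an image of its own hull. If
   [b] is below [a], the predecessor of [a] pulls [b] as well, and the piece between can be cut
   out. *)
have [ba|ba] := kappaP kab; last first.
  left; exists a, (size s2).+1; split=> //.
    by rewrite mem_cat inE eqxx orbT.
  exact: (hull_sub_image (hull_connected tT c a) (hull_l c a) aab).
have [|||[z [j [zs jw zz]]]|[k kw kx]] := IH (s1 ++ b :: s3).
- apply: leq_trans sm; rewrite sE !size_cat /= size_cat /= ltn_add2l.
  by rewrite ltnS leq_addl.
- rewrite cat_path /= ps1 ps3 andbT; apply/pullsP.
  have xa1 := pullsP _ _ xa.
  exact: (hull_sub_image (hull_connected tT c _) (hull_l c _) xa1).
- by case: (s1).
- left; exists z, j; split=> //; move: zs; rewrite !mem_cat !inE mem_cat inE.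
  by case/or3P => ->; rewrite ?orbT.
right; exists k => //; move: kx.
by rewrite !last_cat /= last_cat.
Qed.

Lemma pulled_back_iter z j k : (iter j f @` hull c z) z ->
  (iter (j * k) f @` hull c z) z.
Proof.
move=> zz; elim: k => [|k IH].
  by rewrite muln0; exists z => //; exact: hull_r.
rewrite mulnS image_iterD; apply: image_subset zz.
exact: (hull_sub_image (hull_connected tT c z) (hull_l c z) IH).
Qed.

End FixedPointOrder.

Section RecurrentContinua.
Context {R : realType} {T : metricType R} (cT : compact [set: T])
  (tT : tree_like R [set: T]).
Implicit Types (f : T -> T) (A D : subcontinuum T) (x y z : T).

Let hT : hausdorff_space T. Proof. exact: metric_hausdorff. Qed.

(** If [D] missed [y], its late returns close to [D] would miss [y] too. *)
Lemma Rec_eventually_in f (cf : continuous f) D y N :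
  Rec (induced_map cf) D -> (forall k, (N <= k)%N -> (iter k f @` D) y) -> (D : set T) y.
Proof.
move=> /RecP rD Dy; apply: contrapT => nDy.
have oy : open (~` [set y]).
  exact/closed_openC/accessible_closed_set1/hausdorff_accessible.
have Dy' : (D : set T) `<=` ~` [set y] by move=> x Dx /= xy; rewrite xy in Dx.
have [k Nk kD] := rD _ N (near_subset cT oy Dy').
by have := kD y; rewrite /= iter_induced_mapE => /(_ (Dy k Nk)); apply.
Qed.

Lemma Rec_induced_iter f (cf : continuous f) q (cfq : continuous (iter q f)) D :
  (0 < q)%N -> Rec (induced_map cf) D -> Rec (induced_map cfq) D.
Proof.
by move=> q0 rD; rewrite induced_map_iter; apply: Rec_iter => //;
  exact: induced_map_continuous.
Qed.

Section FixedPoint.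
Context (f : T -> T) (cf : continuous f) (c : T) (fc : f c = c) (w : nat)
  (kappa : T -> 'I_w)
  (kappaP : forall x y, kappa x = kappa y -> hull c x y \/ hull c y x)
  (A : subcontinuum T) (Ac : (A : set T) c) (rA : Rec (induced_map cf) A).

(** A common multiple of all the loop lengths [j <= w] that [pulls_shorten] can produce. *)
Let M := w`!.
Let GA k := iter (k * M) f @` A.
Let M0 : (0 < M)%N. Proof. exact: fact_gt0. Qed.
Let cM : continuous (iter M f). Proof. exact: continuous_iter. Qed.
Let rM : Rec (induced_map cM) A. Proof. exact: Rec_induced_iter rA. Qed.

Let iterGA k : iter k (iter M f) @` A = GA k.
Proof. by rewrite /GA; congr image; apply/funext => x; rewrite iterM. Qed.

(** Every image [GA m] is itself recurrent under [iter M f], so it contains what all its late images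
    contain. *)
Let GA_eventually y N : (forall k, (N <= k)%N -> GA k y) -> forall m, GA m y.
Proof.
move=> yN m; have rD := @Rec_image _ _ (@induced_map_continuous R T cT _ cM) m _ rM.
rewrite -iterGA -(@iter_induced_mapE R T _ cM m A).
apply: (Rec_eventually_in (N := N) rD) => k Nk.
rewrite iter_induced_mapE -image_iterD iterGA.
by apply: yN; apply: leq_trans Nk _; exact: leq_addr.
Qed.

Let P : set T := \bigcap_(k in [set: nat]) GA k.

Let connA : connected (A : set T). Proof. exact: subcontinuum_connected. Qed.

Let P_down y : P y -> hull c y `<=` P.
Proof. by move=> Py z hz k _; apply: (hull_sub_image cf fc connA Ac _ hz); exact: Py. Qed.

Let P_closed : closed P.
Proof.
apply: closed_bigI => k _; apply: compact_closed => //.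
by apply: compact_image_iter => //; exact: subcontinuum_compact.
Qed.

Let GA_mem n k y : GA k y -> GA (n + k) (iter (n * M) f y).
Proof. by rewrite /GA mulnDl; exact: image_iter_mem. Qed.

Let P_image n y : P y -> P (iter (n * M) f y).
Proof.
move=> Py k _; apply: (@GA_eventually _ n) => {}k nk.
by rewrite -(subnKC nk); apply: GA_mem; exact: Py.
Qed.

(** Since [j] divides [M], the loop at [z] can be traversed for any multiple of [M] steps. Inserting
    it between the [l] steps to [z] and the [i] steps to [y] puts [y] in [GA k] for every
    [k >= n]. *)
Let P_absorb z l j i n y : (iter l f @` A) z -> (0 < j <= w)%N ->
  (iter j f @` hull c z) z -> (iter i f @` hull c z) y -> (l + i = n * M)%N ->
  P y.
Proof.
move=> lz jw jz iy lin k _; apply: (@GA_eventually _ n) => {}k nk.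
have /dvdnP[e Me] : (j %| M)%N by apply: dvdn_fact.
have z1 : (iter ((k - n) * M) f @` hull c z) z.
  rewrite Me mulnA mulnC; exact: (pulled_back_iter tT cf fc).
have z2 : (iter ((k - n) * M + l) f @` A) z.
  rewrite image_iterD; apply: image_subset z1.
  exact: (hull_sub_image cf fc connA Ac).
have -> : GA k = iter i f @` (iter ((k - n) * M + l) f @` A).
  rewrite -image_iterD /GA; congr image; congr iter.
  by rewrite addnCA [(i + l)%N]addnC lin -mulnDl subnK.
apply: image_subset iy; exact: (hull_sub_image cf fc connA Ac).
Qed.

(** The maximal points of [A] that obstruct the inclusion of [A] in [P]. Maximality leaves at most
    one of each colour, so there are finitely many. *)
Let bad x := [/\ (A : set T) x, ~ P x & forall z, (A : set T) z -> hull c z x -> z = x].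

Let bad_above y : (A : set T) y -> ~ P y -> exists2 x, bad x & hull c x y.
Proof.
move=> Ay nPy; have [m [Am my max]] :=
  hull_maximal hT tT c (@subcontinuum_compact _ _ A) Ay.
by exists m => //; split=> // Pm; apply: nPy; exact: (P_down Pm).
Qed.

Let bad_color x y : bad x -> bad y -> kappa x = kappa y -> x = y.
Proof.
move=> [Ax _ mx] [Ay _ my] /kappaP[h|h]; first exact: my.
by apply/esym; exact: mx.
Qed.

Let L x := closure (\bigcup_(n in [set n | (0 < n)%N]) (iter (n * M) f @` hull c x)).

(** [L x] is closed, connected and contains [c], so with [y] it contains the hull of [c] and [y]; by
    continuity the iterates of [iter M f] keep it in [L x]. *)
Let L_trans x y : L x y -> L y `<=` L x.
Proof.
move=> Lxy; have conn : connected (L x).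
  apply: connected_closure; apply: bigcup_connected.
    by exists c => n _; exists c; [exact: hull_l|exact: iter_fixed].
  move=> n _; apply: connected_image_iter => //; exact: (hull_connected tT).
have Lc : L x c.
  apply: subset_closure; exists 1%N => //.
  by exists c; [exact: hull_l|exact: iter_fixed].
have hL : hull c y `<=` L x by exact: hull_min.
rewrite (_ : L x = closure (L x)); last exact/closure_id/closed_closure.
apply: closureS => z [n n0 [v /hL Lv <-]].
have : closure (iter (n * M) f @` \bigcup_(n in [set n | (0 < n)%N])
    (iter (n * M) f @` hull c x)) (iter (n * M) f v).
  move=> U nU; have [v' [Bv' Uv']] := Lv _ (continuous_iter cf nU).
  by exists (iter (n * M) f v'); split=> //; exists v'.
apply: closureS => _ [_ [m m0 [u hu <-]] <-].
exists (n + m)%N; first by rewrite /= addn_gt0 m0 orbT.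
by exists u => //; rewrite mulnDl iterD.
Qed.

(** Otherwise a neighbourhood of [x] avoids [P] and the finitely many closed sets [L x']. A return
    of [A] meets it in an image of some [z] outside [P]; a bad point above [z] has that image in its
    [L]. *)
Let bad_pred x : bad x -> exists2 x', bad x' & L x' x.
Proof.
move=> [Ax nPx mx]; apply: contrapT => nox'.
have near_x : nbhs x [set y | forall i : 'I_w, forall x', bad x' ->
    kappa x' = i -> ~ L x' y].
  apply: filter_forall => i.
  have [[x' bx' x'i]|no] := pselect (exists2 x', bad x' & kappa x' = i).
    have : nbhs x (~` L x').
      apply: open_nbhs_nbhs; split; first exact/closed_openC/closed_closure.
      by move=> Lx'; apply: nox'; exists x'.
    apply: filterS => y nL x'' bx'' x''i.
    by rewrite (bad_color bx'' bx')// x''i.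
  by apply: filterS filterT => y _ x' bx' x'i; exfalso; apply: no; exists x'.
have xP : nbhs x (~` P).
  by apply: open_nbhs_nbhs; split=> //; exact: closed_openC.
have [n n1 [y [Ay Uy]]] := (RecP _ _).1 rM _ 1%N
  (near_meets cT (open_interior _)
    (ex_intro _ x (conj Ax (filterI near_x xP)))).
have [nL nPy] := nbhs_singleton Uy.
move: Ay; rewrite iter_induced_mapE iterGA => -[z Az zy].
have nPz : ~ P z by move=> Pz; apply: nPy; rewrite -zy; exact: P_image.
have [x' bx' x'z] := bad_above Az nPz.
apply: (nL (kappa x') x' bx' erefl); apply: subset_closure.
by exists n => //; exists z.
Qed.

(** Choose a bad [y] with the most colours of bad points in [L y]. A predecessor [y'] has at least
    these colours, hence exactly these; as [y] is in [L y'], its colour already occurs for [y], and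
    colours determine bad points. *)
Let bad_loop x : bad x -> exists2 y, bad y & L y y.
Proof.
move=> bx; pose N y := [set i | `[< exists x', [/\ bad x', kappa x' = i & L y x'] >]]%SET.
pose Q n := `[< exists2 y, bad y & #|N y| = n >].
have [|n Qn|n /asboolP[y by_ Ny] max] := @ex_maxnP Q w.
- by exists #|N x|; apply/asboolP; exists x.
- by move/asboolP: Qn => [y _ <-]; rewrite -[w in (_ <= w)%N]card_ord max_card.
have [y' by' Ly'y] := bad_pred by_.
have sub : N y \subset N y'.
  apply/fintype.subsetP => i; rewrite !finset.in_set => /asboolP[x' [bx' ix' Lyx']].
  by apply/asboolP; exists x'; split=> //; exact: (L_trans Ly'y Lyx').
have eqN : N y = N y'.
  apply/eqP; rewrite eqEcard sub Ny; apply: max; apply/asboolP.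
  by exists y'.
have : kappa y \in N y by rewrite eqN finset.in_set; apply/asboolP; exists y.
rewrite finset.in_set => /asboolP[x' [bx' e Lyx']].
by exists y => //; rewrite -{2}(bad_color bx' by_ e).
Qed.

(** A bad [x] with [x] in [L x] is impossible by the shortening of chains. So [A] lies in [P], which
    gives both inclusions between [A] and its image. *)
Lemma recurrent_fixed_periodic : iter M (induced_map cf) A = A.
Proof.
have w0 : (0 < w)%N by apply: leq_ltn_trans (ltn_ord (kappa c)).
have nobad x : ~ bad x.
  move=> /bad_loop[{}x [Ax nPx mx] Lxx].
  have short k : (0 < k <= w)%N -> ~ (iter k f @` hull c x) x.
    move=> kw kx; apply: nPx; apply: (@P_absorb x 0 k 0 0) => //.
      by exists x.
    by exists x => //; exact: hull_r.
  have nx : nbhs x [set y | forall k : 'I_w, ~ (iter k.+1 f @` hull c x) y].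
    apply: filter_forall => k; apply: open_nbhs_nbhs; split.
      apply: closed_openC; apply: compact_closed => //.
      apply: compact_image_iter => //.
      by apply: subclosed_compact cT _; first exact: (hull_closed hT tT).
    by apply: short; rewrite /= ltn_ord.
  have nP : nbhs x (~` P).
    by apply: open_nbhs_nbhs; split=> //; exact: closed_openC.
  have [y [[n /= n0 [v hv vy]] [ny nPy]]] := Lxx _ (filterI nx nP).
  have nM : (0 < n * M)%N by rewrite muln_gt0 n0.
  have vA : (A : set T) v by apply: (hull_min connA Ac Ax).
  (* The orbit of [v] is a chain starting from [x]: [v] lies below [x], and every point pulls its
     own image. *)
  have ps : path (pulls f c) x (traject f (f v) (n * M)).
    have fv z : pulls f c z (f z) by apply/pullsP; exists z => //; exact: hull_r.
    rewrite -(prednK nM) /=; apply/andP; split.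
      by apply/pullsP; exists v.
    by elim: (n * M).-1 (f v) => //= m IH z; rewrite fv IH.
  have lasty : last x (traject f (f v) (n * M)) = y.
    by rewrite -(prednK nM) /= last_traject -iterSr prednK.
  (* A loop at an orbit point puts [y] in [P]; a shortened chain puts [y] in one of the finitely
     many closed sets avoided by the neighbourhood of [x]. *)
  have [|[z [j [/trajectP[l lM zl] jw jz]]]|[k kw kx]] :=
      pulls_shorten tT cf fc kappaP ps.
  - by rewrite -(prednK nM).
  - apply: nPy; apply: (@P_absorb z l.+1 j (n * M - l.+1) n) => //.
    + by exists v => //; rewrite zl -iterSr.
    + exists z; first exact: hull_r.
      by rewrite zl -iterSr -iterD subnK.
    + by rewrite subnKC.
  - rewrite lasty in kx; case: k kw kx => // k kw kx.
    exact: (ny (Ordinal kw) kx).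
have AP : (A : set T) `<=` P.
  by move=> y Ay; apply: contrapT => /(bad_above Ay)[x /nobad].
apply: subcontinuum_inj; rewrite iter_induced_mapE; apply/seteqP; split=> y.
  move=> [z /AP Pz <-]; have := P_image 1 Pz; rewrite mul1n.
  by move/(_ 0%N I) => [v Av <-].
by move=> /AP/(_ 1%N I); rewrite /GA mul1n.
Qed.

End FixedPoint.

(** The gate of a connected union of images of [D] is either fixed, or so close to its image that
    both lie in a set which [f] moves off itself. *)
Lemma recurrent_fixed_point f (cf : continuous f) D : Rec (induced_map cf) D ->
  (f @` D) `&` D !=set0 -> exists2 c, (D : set T) c & f c = c.
Proof.
move=> rD [x0 [[d0 Dd0 fd0] Dx0]]; apply: contrapT => nofix.
(* [Y] is the union of the images of [D] up to order [n], connected because consecutive images meet;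
   a point leaving it lands in the next image. *)
have chain n : exists Y : set T, [/\ compact Y, connected Y,
    (D : set T) `<=` Y /\ iter n f @` D `<=` Y,
    forall y, Y y -> exists k, (iter k f @` D) y &
    forall y, Y y -> Y (f y) \/ (iter n.+1 f @` D) (f y)].
  elim: n => [|n [Y [cY coY [DY DnY] Yk Yf]]].
    exists D; split.
    - exact: subcontinuum_compact.
    - exact: subcontinuum_connected.
    - by split=> //; rewrite image_id.
    - by move=> y Dy; exists 0%N; exists y.
    - by move=> y Dy; right; exists y.
  exists (Y `|` iter n.+1 f @` D); split.
  - apply: compactU => //; apply: compact_image_iter => //.
    exact: subcontinuum_compact.
  - apply: connectedU => //.
      exists (iter n f x0); split; first by apply: DnY; exists x0.
      by exists d0 => //; rewrite iterSr fd0.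
    by apply: connected_image_iter => //; exact: subcontinuum_connected.
  - by split=> y ?; [left; exact: DY|right].
  - by move=> y [/Yk//|?]; exists n.+1.
  - move=> y [/Yf[?|?]|[d Dd <-]]; [by left; left|by left; right|right].
    by exists d.
pose nice a N := [/\ (D : set T) a, connected N, N a &
  forall u v, N u -> N v -> f u <> v].
pose U : set T := [set x | exists a N, nice a N /\ N° x].
have oU : open U.
  rewrite openE => x [a [N [aN Nx]]].
  have : nbhs x N° by apply: open_nbhs_nbhs; split=> //; exact: open_interior.
  by apply: filterS => y Ny; exists a, N.
have DU : (D : set T) `<=` U.
  move=> a Da; have fa : f a <> a by move=> e; apply: nofix; exists a.
  have [A [B [Aa Bfa AB]]] : exists A B : set T,
      [/\ nbhs a A, nbhs (f a) B & A `&` B = set0].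
    apply: contrapT => noAB; apply: fa; apply/esym; apply: hT => A B Aa Bfa.
    by apply/set0P/eqP => AB; apply: noAB; exists A, B.
  have aV : nbhs a (A `&` f @^-1` B) by apply: filterI => //; exact: (cf a).
  have [N [NV cN aN]] := connected_nbhs tT aV.
  exists a, N; split=> //; split=> //; first exact: nbhs_singleton.
  move=> u v /NV[_ Bfu] /NV[Av _] e.
  have : (A `&` B) v by split=> //; rewrite -e.
  by rewrite AB.
have [[//|n] _ nU] := (RecP _ _).1 rD _ 1%N (near_subset cT oU DU).
have [Y [cY coY [DY _] Yk Yf]] := chain n.
have [x Yx gx] := gate_fixed_point hT tT cf cY coY (ex_intro _ x0 (DY _ Dx0)).
(* If [f x] is in [Y], the gate property makes [x] fixed; it then stays in all later images of [D],
   hence lies in [D]. *)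
case: (Yf x Yx) => [Yfx|].
  have := gx _ Yfx; rewrite hullxx /= => fx; apply: nofix; exists x => //.
  have [k kx] := Yk x Yx; apply: (Rec_eventually_in (N := k) rD) => m km.
  rewrite -(subnK km) -(iter_fixed (esym fx) (m - k)); exact: image_iter_mem.
(* Otherwise [f x] is in some [N] through a point [a] of [D]. The hull of [f x] and [a] lies in [N]
   and contains the gate [x], so [f] maps a point of [N] into [N]. *)
rewrite -(iter_induced_mapE cf) => /nU[a [N [[Da cN Na Nf] Nfx]]].
have Nfx' : N (f x) by exact: interior_subset Nfx.
have Nx : N x by apply: (hull_min cN Nfx' Na); apply: gx; exact: DY.
exact: (Nf _ _ Nx Nfx').
Qed.

Lemma recurrent_meet_periodic : exists2 M, (0 < M)%N &
  forall f (cf : continuous f) D n q, Rec (induced_map cf) D -> (0 < q)%N ->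
    (iter n f @` D) `&` (iter (n + q) f @` D) !=set0 ->
    iter (M * q) (induced_map cf) D = D.
Proof.
have [r widthr] := hull_width tT; exists (r.+1)`!; first exact: fact_gt0.
move=> f cf D n q rD q0 meet.
have cg : continuous (iter q f) by exact: continuous_iter.
have cF := @induced_map_continuous R T cT _ cf.
have rB := @Rec_image _ _ cF n _ rD.
have [||c Bc gc] := @recurrent_fixed_point _ cg (iter n (induced_map cf) D).
- exact: Rec_induced_iter rB.
- rewrite iter_induced_mapE -image_iterD addnC setIC; exact: meet.
have rgD : Rec (induced_map cg) D by exact: Rec_induced_iter rD.
have iq k E : iter k (iter q f) @` E = iter (k * q) f @` E.
  by congr image; apply/funext => x; rewrite iterM.
(* The fixed point found lies in the image of order [n]; [n * q.-1] further steps bring it to the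
   image of order [n * q], an image of [D] under [iter q f], and recurrence puts it in [D]. *)
pose c' := iter (n * q.-1) f c.
have gc' : iter q f c' = c' by rewrite /c' -iterD addnC iterD gc.
have Dc' : (D : set T) c'.
  apply: (Rec_eventually_in (N := n) rgD) => k nk.
  rewrite -(iter_fixed gc' (k - n)) -{1}(subnK nk); apply: image_iter_mem.
  move: Bc; rewrite iq iter_induced_mapE => /(image_iter_mem (n * q.-1)).
  by rewrite -{2}[n]muln1 -mulnDr addn1 prednK.
have [kappa kP] := widthr c'.
rewrite iterM -(@induced_map_iter R T f cf q cg).
exact: (recurrent_fixed_periodic gc' kP Dc' rgD).
Qed.

End RecurrentContinua.

Lemma near_not_fixed (X : topologicalType) (g : X -> X) x :
  hausdorff_space X -> continuous g -> g x <> x -> \forall y \near x, g y <> y.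
Proof.
move=> hX cg gx; have [A [B [Ax Bgx AB]]] : exists A B : set X,
    [/\ nbhs x A, nbhs (g x) B & A `&` B = set0].
  apply: contrapT => noAB; apply: gx; apply/esym; apply: hX => A B Aa Bfa.
  by apply/set0P/eqP => AB; apply: noAB; exists A, B.
have : nbhs x (A `&` g @^-1` B) by apply: filterI => //; exact: (cg x).
apply: filterS => y [Ay Bgy] gy.
have : (A `&` B) y by split=> //; rewrite -gy.
by rewrite AB.
Qed.

Lemma iter_period (X : Type) (g : X -> X) x n k :
  iter n g x = x -> iter (k * n) g x = x.
Proof. by move=> gx; rewrite iterM iter_fix. Qed.

(** * Limits of recurrent subcontinua *)

Section AsymptoticallyDegenerate.
Context {R : realType} {T : metricType R} (cT : compact [set: T])
  (f : T -> T) (cf : continuous f).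
Implicit Types (A D : subcontinuum T) (x y z : T).

Lemma asymptotically_degenerateP A : asymptotically_degenerate f A <->
  forall e, 0 < e -> exists N, forall n, (N <= n)%N -> forall x y,
    (iter n f @` A) x -> (iter n f @` A) y -> mdist x y < e.
Proof.
have [M HM] := mdist_bounded cT.
have ubd (C : set T) : has_ubound [set (mdist p.1 p.2 : R) | p in C `*` C].
  by exists M => _ [p _ <-].
have [a Aa] := subcontinuum_neq0 A.
have diam0 n : 0 <= diam (iter n f @` A).
  rewrite -(mdistxx (iter n f a)); apply: ub_le_sup => //.
  by exists (iter n f a, iter n f a) => //; split; exists a.
split=> [/cvgrPdist_lt h e e0|h].
  have [N _ hN] := h e e0; exists N => n Nn x y Ax Ay.
  have := hN n Nn; rewrite /= sub0r normrN ger0_norm//; apply: le_lt_trans.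
  by apply: ub_le_sup => //; exists (x, y).
apply/cvgrPdist_le => e e0; have [N hN] := h e e0.
exists N => // n /= Nn; rewrite sub0r normrN ger0_norm//; apply: ge_sup.
  by exists (mdist (iter n f a) (iter n f a)), (iter n f a, iter n f a) => //;
    split; exists a.
by move=> _ [[x y] [/= Ax Ay] <-]; apply: ltW; exact: (hN n).
Qed.

Lemma nondegenerate_points A : nondegenerate_continuum A ->
  exists a b, [/\ (A : set T) a, (A : set T) b & a <> b].
Proof.
move=> nA; have [a Aa] := subcontinuum_neq0 A.
apply: contrapT => noab; apply: nA; exists a; apply/seteqP; split=> [b Ab|_ ->//].
by apply: contrapT => ba; apply: noab; exists a, b; split=> // /esym.
Qed.

Lemma asymptotically_degenerate_aperiodic A n : nondegenerate_continuum A ->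
  asymptotically_degenerate f A -> (0 < n)%N -> iter n (induced_map cf) A <> A.
Proof.
move=> /nondegenerate_points[a [b [Aa Ab /eqP ab]]].
move=> /asymptotically_degenerateP/(_ (mdist a b)).
rewrite mdist_gt0 => /(_ ab)[N hN] n0 nA.
have NA := iter_period N nA.
have {}hN := hN (N * n)%N (leq_pmulr _ n0) a b.
by move: hN; rewrite -(iter_induced_mapE cf) NA ltxx => /(_ Aa Ab).
Qed.

Lemma near_image_meets n A (U : set T) : open U ->
  (iter n f @` A) `&` U !=set0 ->
  \forall D \near A, (iter n f @` subcontinuum_set D) `&` U !=set0.
Proof.
move=> oU [_ [[a Aa <-] Ua]].
have cn : continuous (iter n f) by exact: continuous_iter.
have oV : open (iter n f @^-1` U) by apply: open_comp => // x _; exact: cn.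
have AV : (A : set T) `&` (iter n f @^-1` U) !=set0 by exists a.
apply: filterS (near_meets cT oV AV) => D [d [Dd Ud]].
by exists (iter n f d); split=> //; exists d.
Qed.

(** Being moved by a continuous map is an open condition, so if [A] were moved, some recurrent
    continuum near [A] would be moved too. *)
Lemma periodic_limit A n : birkhoff_center (induced_map cf) A ->
  (\forall D \near A, Rec (induced_map cf) D -> iter n (induced_map cf) D = D) ->
  iter n (induced_map cf) A = A.
Proof.
move=> CA nA; apply: contrapT => An.
have cFn : continuous (iter n (induced_map cf)).
  by apply: continuous_iter; exact: induced_map_continuous.
have An' := near_not_fixed (@metric_hausdorff R (subcontinuum T)) cFn An.
by have [D [rD [/(_ rD) nD]]] := CA _ (filterI nA An').
Qed.

Context (tT : tree_like R [set: T]).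

Let hT : hausdorff_space T. Proof. exact: metric_hausdorff. Qed.

(** A point separating two points of [A] lies in every continuum near [A]. The same applies around a
    recurrent [D] near [A]: a return of [D] contains [x] as well, so [D] meets its image and is
    periodic. *)
Lemma nondegenerate_stable_point A : nondegenerate_continuum A ->
  exists x, \forall D \near A, subcontinuum_set D x /\ (Rec (induced_map cf) D ->
    exists2 n, (0 < n)%N & iter n (induced_map cf) D = D).
Proof.
have [M M0 HM] := recurrent_meet_periodic cT tT.
move=> /nondegenerate_points[a [b [Aa Ab ab]]].
have [x [U [V [oU oV Ua Vb UVx]]]] := separating_point hT tT ab.
exists x.
have nearx (B : subcontinuum T) : (B : set T) `&` U !=set0 ->
    (B : set T) `&` V !=set0 -> \forall D \near B,
      [/\ subcontinuum_set D `&` U !=set0, subcontinuum_set D `&` V !=set0 &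
          subcontinuum_set D x].
  move=> BU BV; apply: filterS (filterI (near_meets cT oU BU) (near_meets cT oV BV)).
  move=> D [DU DV]; split=> //; apply: UVx => //.
  exact: subcontinuum_connected.
have nAx := nearx A (ex_intro _ a (conj Aa Ua)) (ex_intro _ b (conj Ab Vb)).
apply: filterS nAx => D [DU DV Dx]; split=> // rD.
have [n n0 [_ _]] := (RecP _ _).1 rD _ 1%N (nearx D DU DV).
rewrite iter_induced_mapE => nDx.
exists (M * n)%N; first by rewrite muln_gt0 M0.
apply: (HM _ _ _ 0%N) => //; exists x; split=> //.
by exists x.
Qed.

(** If diameters do not tend to 0, pairs of points of the iterates at distance at least [e] cluster
    at some [(a, b)] off the diagonal. A point separating [a] from [b] lies in arbitrarily late
    iterates of [A] and, for each such time, in those of all nearby [D]. *)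
Lemma periodic_or_asymptotically_degenerate A :
  birkhoff_center (induced_map cf) A ->
  periodic (induced_map cf) A \/ asymptotically_degenerate f A.
Proof.
have [M M0 HM] := recurrent_meet_periodic cT tT.
move=> CA; have [dA|ndA] := pselect (asymptotically_degenerate f A); [by right|left].
have [e e0 he] : exists2 e : R, 0 < e & forall N, exists n x y, [/\ (N <= n)%N,
    (iter n f @` A) x, (iter n f @` A) y & e <= mdist x y].
  apply: contrapT => noe; apply: ndA; apply/asymptotically_degenerateP => e e0.
  apply: contrapT => noN; apply: noe; exists e => // N.
  apply: contrapT => non; apply: noN; exists N => n Nn x y Ax Ay.
  by rewrite ltNge; apply/negP => exy; apply: non; exists n, x, y.
pose W N := [set p : T * T | exists n, [/\ (N <= n)%N,
    (iter n f @` A) p.1, (iter n f @` A) p.2 & e <= mdist p.1 p.2]].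
pose FW := filter_from [set: nat] W.
have FF : ProperFilter FW.
  apply: filter_from_proper; last first.
    by move=> N _; have [n [x [y [Nn Ax Ay exy]]]] := he N; exists (x, y), n.
  apply: filter_from_filter; first by exists 0%N.
  move=> m n _ _; exists (maxn m n) => // p [l [ml Ax Ay exy]].
  by split; exists l; split=> //; apply: leq_trans ml; rewrite leq_max leqnn ?orbT.
have cTT : compact ([set: T] `*` [set: T]) by exact: compact_setX.
have [[a b] [_ clab]] := cTT FW FF (ex_intro2 _ _ 0%N I (fun p _ => conj I I)).
have ab : a <> b.
  move=> ab; rewrite -ab in clab.
  have aV : nbhs (a, a) [set p : T * T | mdist p.1 p.2 < e].
    apply: (@mdist_continuous R T (a, a) [set r | r < e]).
    apply: open_nbhs_nbhs; split; first exact: open_lt.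
    by rewrite /= mdistxx.
  have [p [[n [_ _ _ ep]] /= pe]] :=
    clab (W 0%N) _ (ex_intro2 _ _ 0%N I (fun _ h => h)) aV.
  by move: ep; rewrite leNgt pe.
have [x [U [V [oU oV Ua Vb UVx]]]] := separating_point hT tT ab.
have abUV : nbhs (a, b) (U `*` V).
  by exists (U, V) => //; split; apply: open_nbhs_nbhs.
have visit N : exists2 n, (N <= n)%N &
    \forall D \near A, (iter n f @` subcontinuum_set D) x.
  have [p [[n [Nn A1 A2 _]] [U1 V2]]] :=
    clab (W N) _ (ex_intro2 _ _ N I (fun _ h => h)) abUV.
  exists n => //.
  have nU : (iter n f @` A) `&` U !=set0 by exists p.1.
  have nV : (iter n f @` A) `&` V !=set0 by exists p.2.
  apply: filterS (filterI (near_image_meets oU nU) (near_image_meets oV nV)).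
  move=> D [DU DV]; apply: UVx => //; apply: connected_image_iter => //.
  exact: subcontinuum_connected.
have [m _ nm] := visit 0%N; have [n mn nn] := visit m.+1.
exists (M * (n - m))%N; first by rewrite muln_gt0 M0 subn_gt0.
apply: periodic_limit => //; apply: filterS (filterI nm nn) => D [Dm Dn] rD.
apply: (HM _ _ _ m) => //; first by rewrite subn_gt0.
by exists x; split=> //; rewrite subnKC// ltnW.
Qed.

Lemma asymptotically_degenerate_images_disjoint A m k :
  birkhoff_center (induced_map cf) A -> nondegenerate_continuum A ->
  asymptotically_degenerate f A -> (m < k)%N ->
  (iter m f @` A) `&` (iter k f @` A) = set0.
Proof.
have [M M0 HM] := recurrent_meet_periodic cT tT.
move=> CA nA dA mk; apply: contrapT => /eqP/set0P[p [pm pk]].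
have [x nx] := nondegenerate_stable_point nA.
have [Ax _] := nbhs_singleton nx.
have q0 : (0 < k - m)%N by rewrite subn_gt0.
apply: (@asymptotically_degenerate_aperiodic A (M * (k - m))) => //.
  by rewrite muln_gt0 M0.
apply: periodic_limit => //; apply: filterS nx => D [Dx _] rD.
apply: (HM _ _ _ m) => //; rewrite subnKC ?(ltnW mk)//.
apply: contrapT => disj.
have cq : continuous (iter (k - m) f) by exact: continuous_iter.
have ckD : compact (iter k f @` D).
  by apply: compact_image_iter => //; exact: subcontinuum_compact.
have [|||e e0 he] := @compact_uniform_nbhs R T (iter m f @` D) (~` (iter k f @` D)).
- by apply: compact_image_iter => //; exact: subcontinuum_compact.
- by apply: closed_openC; exact: (compact_closed hT).
- by move=> y my ky; apply: disj; exists y.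
(* Disjointness makes [iter (k - m) f] move each point of the [m]-th image of [D] by at least [e].
   The strict bound [e / 2] is an open condition, so late returns of that image satisfy it. *)
pose U := [set z | e / 2 < mdist z (iter (k - m) f z)].
have oU : open U.
  have cd : continuous (fun z => mdist z (iter (k - m) f z) : R).
    move=> z; apply: (@continuous_comp _ _ _ (fun z => (z, iter (k - m) f z))
      (fun p : T * T => mdist p.1 p.2)); last exact: mdist_continuous.
    by apply: cvg_pair; [exact: cvg_id|exact: cq].
  by apply: (@open_comp _ _ _ [set r | e / 2 < r]) => [z _|]; [exact: cd|exact: open_gt].
have rE := @Rec_image _ _ (@induced_map_continuous R T cT _ cf) m _ rD.
have EU : (iter m (induced_map cf) D : set T) `<=` U.
  rewrite iter_induced_mapE => z mz; rewrite /U /=.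
  suff : e <= mdist z (iter (k - m) f z).
    by apply: lt_le_trans; rewrite ltr_pdivrMr// ltr_pMr// ltr1n.
  rewrite leNgt; apply/negP => /(he _ _ mz); apply.
  by have := image_iter_mem (k - m) mz; rewrite subnK// ltnW.
(* At late times both orbit points of [x] are within [e / 4] of the same iterate of [p], hence less
   than [e / 2] apart. *)
have e4 : 0 < e / 4 by exact: divr_gt0.
have [N hN] := (asymptotically_degenerateP A).1 dA _ e4.
have [j Nj jU] := (RecP _ _).1 rE _ N (near_subset cT oU EU).
have zA l : (iter (j + l) f @` A) (iter (j + l) f x) by exists x.
have /jU : (iter j (induced_map cf) (iter m (induced_map cf) D) : set T)
    (iter (j + m) f x).
  by rewrite -iterD iter_induced_mapE; exists x.
rewrite /U /= -iterD addnCA subnK ?(ltnW mk)// => far.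
have N1 l : (N <= j + l)%N by apply: leq_trans Nj _; exact: leq_addr.
have d1 := hN _ (N1 m) _ _ (zA m) (image_iter_mem j pm).
have d2 := hN _ (N1 k) _ _ (image_iter_mem j pk) (zA k).
have := metric_triangle (iter (j + m) f x) (iter j f p) (iter (j + k) f x).
lra.
Qed.

Lemma asymptotically_degenerate_sub A B :
  birkhoff_center (induced_map cf) A -> birkhoff_center (induced_map cf) B ->
  nondegenerate_continuum A -> asymptotically_degenerate f A ->
  nondegenerate_continuum B -> asymptotically_degenerate f B ->
  A `&` B !=set0 -> (B : set T) `<=` A.
Proof.
have [M M0 HM] := recurrent_meet_periodic cT tT.
have [r widthr] := hull_width tT.
move=> CA CB nA dA nB dB [z [Az Bz]] b Bb; apply: contrapT => nAb.
have [x nx] := nondegenerate_stable_point nA.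
have [y ny] := nondegenerate_stable_point nB.
have [Ax _] := nbhs_singleton nx; have [By_ _] := nbhs_singleton ny.
have ob : open (~` [set b]).
  exact/closed_openC/accessible_closed_set1/hausdorff_accessible.
have Ab' : (A : set T) `<=` ~` [set b] by move=> u Au /= ub; rewrite ub in Au.
have [D [rD [[Dx perD] Db]]] := CA _ (filterI nx (near_subset cT ob Ab')).
have [P P0 PD] := perD rD.
have nDb : ~ (D : set T) b by move=> Dbb; exact: (Db _ Dbb).
(* A multiple of every period [M * ((j - i) * P)] with [0 < j - i <= r.+1]. *)
pose N := ((r.+1)`! * (M * P))%N.
have N0 : (0 < N)%N by rewrite !muln_gt0 fact_gt0 M0.
have NB := asymptotically_degenerate_aperiodic nB dB N0.
have cFN : continuous (iter N (induced_map cf)).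
  by apply: continuous_iter; exact: induced_map_continuous.
have nNB := near_not_fixed (@metric_hausdorff R (subcontinuum T)) cFN NB.
have oD : open (~` (D : set T)) by exact/closed_openC/subcontinuum_closed.
have BD : (B : set T) `&` ~` (D : set T) !=set0 by exists b.
have [E [rE [[[Ey perE] NE] [v [Ev nDv]]]]] :=
  CB _ (filterI (filterI ny nNB) (near_meets cT oD BD)).
have [Q Q0 QE] := perE rE.
have itD k : iter (k * P) f @` D = D.
  by rewrite -(iter_induced_mapE cf) iter_period.
(* The orbits of [x] and [y] both approach that of [z], and at common multiples of the periods they
   are back in [D] and [E]; so these compact sets cannot be a positive distance apart. *)
have [c [Dc Ec]] : (D : set T) `&` E !=set0.
  apply: contrapT => disj.
  have [|||e e0 he] := @compact_uniform_nbhs R T D (~` (E : set T)).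
  - exact: subcontinuum_compact.
  - exact/closed_openC/subcontinuum_closed.
  - by move=> u Du Eu; apply: disj; exists u.
  have e2 : 0 < e / 2 by exact: divr_gt0.
  have [N1 h1] := (asymptotically_degenerateP A).1 dA _ e2.
  have [N2 h2] := (asymptotically_degenerateP B).1 dB _ e2.
  pose n := ((N1 + N2) * Q * P)%N.
  have nN : (N1 + N2 <= n)%N by rewrite /n -mulnA leq_pmulr// muln_gt0 Q0.
  have Dn : (D : set T) (iter n f x) by rewrite -(itD ((N1 + N2) * Q)%N); exists x.
  have En : (E : set T) (iter n f y).
    have <- : iter n (induced_map cf) E = E.
      by rewrite /n mulnAC; exact: iter_period.
    by rewrite iter_induced_mapE; exists y.
  apply: (he _ (iter n f y) Dn) => //.
  have d1 : mdist (iter n f x) (iter n f z) < e / 2.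
    by apply: (h1 n); [exact: leq_trans (leq_addr _ _) nN|exists x|exists z].
  have d2 : mdist (iter n f z) (iter n f y) < e / 2.
    by apply: (h2 n); [exact: leq_trans (leq_addl _ _) nN|exists z|exists y].
  by have := metric_triangle (iter n f x) (iter n f z) (iter n f y); lra.
(* If the image of order [k * P] were inside [D], further steps up to [k * P * Q] would keep it in
   [D] and bring it back to [E], which is not contained in [D]. *)
have notsub k : exists u, (iter (k * P) f @` E) u /\ ~ (D : set T) u.
  apply: contrapT => nou; apply: nDv.
  have kED : iter (k * P) f @` E `<=` D.
    by move=> u Eu; apply: contrapT => nDu; apply: nou; exists u.
  have : (iter (k * P * Q) f @` E) v.
    by rewrite -(iter_induced_mapE cf) iter_period.
  rewrite -(prednK Q0) mulnS addnC image_iterD => -[u /kED Du <-].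
  by rewrite mulnAC -(itD (k * Q.-1)%N); exists u.
have [u hu] := choice notsub.
have [kappa kP] := widthr c.
have disj i j : (i < j)%N -> (j <= r.+1)%N ->
    ~ ((iter (i * P) f @` E) `&` (iter (j * P) f @` E) !=set0).
  move=> ij jr meet; apply: NE.
  have ji0 : (0 < j - i)%N by rewrite subn_gt0.
  have jir : (j - i <= r.+1)%N by apply: leq_trans jr; exact: leq_subr.
  have /dvdnP[d dE] : (j - i %| (r.+1)`!)%N by rewrite dvdn_fact// ji0.
  have -> : N = (d * (M * ((j - i) * P)))%N.
    by rewrite /N dE -mulnA; congr muln; rewrite mulnCA.
  apply: iter_period; apply: (HM _ _ _ (i * P)%N) => //.
    by rewrite muln_gt0 ji0.
  by rewrite -mulnDl subnKC// ltnW.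
(* The hull of [c] and [u j] lies in the union of [D] and the [j]-th image, connected because both
   contain the same iterate of [c]; as [u i] is not in [D], it falls in that image. *)
have below i j : hull c (u j) (u i) -> (iter (j * P) f @` E) (u i).
  move=> hij; have : ((iter (j * P) f @` E) `|` D) (u i).
    apply: (hull_min _ _ _ hij); [|by right|by left; case: (hu j)].
    apply: connectedU.
    - exists (iter (j * P) f c); split; first by exists c.
      by rewrite -(itD j); exists c.
    - by apply: connected_image_iter => //; exact: subcontinuum_connected.
    - exact: subcontinuum_connected.
  by case=> // Du; case: (hu i).
have [i [j [ij kij]]] : exists i j : 'I_r.+2, (i < j)%N /\ kappa (u i) = kappa (u j).
  have /injectivePn[i [j ij kij]] : ~~ injectiveb (fun i : 'I_r.+2 => kappa (u i)).
    by apply/negP => /injectiveP/leq_card; rewrite !card_ord ltnn.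
  by have [lt|lt|e] := ltngtP i j;
    [exists i, j|exists j, i|move: ij; rewrite -val_eqE/= e eqxx].
apply: (disj i j ij) => //; first by rewrite -ltnS.
have [hi _] := hu i; have [hj _] := hu j.
by case: (kP _ _ kij) => h; [exists (u j)|exists (u i)]; split=> //; exact: below h.
Qed.

End AsymptoticallyDegenerate.

Theorem theorem5p1 (R : realType) (T : metricType R) (hT : topological_tree T)
    (f : T -> T) (cf : continuous f) :
  let C : set (subcontinuum T) := birkhoff_center (induced_map cf) in
  [/\ (forall A : subcontinuum T, C A -> nondegenerate_continuum A ->
         periodic (induced_map cf) A \/ asymptotically_degenerate f A),
      (forall A B : subcontinuum T, C A -> C B -> A <> B ->
         nondegenerate_continuum A -> asymptotically_degenerate f A ->
         nondegenerate_continuum B -> asymptotically_degenerate f B ->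
         A `&` B = set0) &
      (forall A : subcontinuum T, C A ->
         nondegenerate_continuum A -> asymptotically_degenerate f A ->
         forall m k : nat, (m < k)%N ->
         (iter m f @` A) `&` (iter k f @` A) = set0)].
Proof.
have tT := topological_tree_like hT.
have cT : compact [set: T] by case: hT => -[[]].
move=> C; split.
- by move=> A CA _; exact: periodic_or_asymptotically_degenerate.
- move=> A B CA CB AB nA dA nB dB; apply: contrapT => /eqP/set0P meet.
  apply: AB; apply: subcontinuum_inj; apply/seteqP; split.
    apply: (asymptotically_degenerate_sub cT tT CB CA) => //.
    by rewrite setIC.
  exact: (asymptotically_degenerate_sub cT tT CA CB).
- by move=> A CA nA dA m k; exact: (asymptotically_degenerate_images_disjoint cT tT CA).
Qed.
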